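(* Let $m\ge1$ and let $\phi\in C^\infty(\mathbb R^2)$ satisfy, for some $C>0$ and all $z\in\mathbb R^2$, $|D^3\phi(z)|\le C|z|^{2m-1}$, $|D^2\phi(z)|\le C|z|^{2m}$, $|D\phi(z)|\le C|z|^{2m+1}$. Then the epigraph $\mathrm{epi}(\phi)=\{(z,t)\in\mathbb R^3:t>\phi(z)\}$ is a uniform domain in $(\mathbb R^3,d)$: there exist $\varepsilon,\delta>0$ such that for every $p,q\in\mathrm{epi}(\phi)$ there is a continuous curve $\gamma:[0,1]\to\mathrm{epi}(\phi)$ with $\gamma(0)=p$, $\gamma(1)=q$, $\operatorname{diam}(\gamma)\le\delta^{-1}d(p,q)$ and $B(\gamma(t),\varepsilon\Delta_t)\subset\mathrm{epi}(\phi)$ for all $t\in[0,1]$, where $\Delta_t=\min\{\operatorname{diam}(\gamma|_{[0,t]}),\operatorname{diam}(\gamma|_{[t,1]})\}$.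
   Context: Write points of $\mathbb R^3=\mathbb C\times\mathbb R$ as $(z,t)=(x,y,t)$. For a real parameter $m\ge1$ consider the vector fields $X=\partial_x+|z|^{2m}y\,\partial_t$ and $Y=\partial_y-|z|^{2m}x\,\partial_t$. An absolutely continuous curve $\gamma:[0,1]\to\mathbb R^3$ is horizontal if $\dot\gamma(s)=\alpha(s)X(\gamma(s))+\beta(s)Y(\gamma(s))$ for a.e. $s$, with length $\int_0^1|(\alpha(s),\beta(s))|\,ds$; the Carnot–Carathéodory distance $d(p,q)$ is the infimum of lengths of horizontal curves joining $p$ to $q$, $B(p,r)=\{q:d(p,q)<r\}$, and diameters are taken with respect to $d$. $|D^k\phi(z)|$ is the maximum of the absolute values of all $k$-th order partial derivatives of $\phi$ at $z$. *)

(* Defs.v *)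
From Stdlib Require Import Reals Lra Lia.
Open Scope R_scope.

Definition R3 : Type := (R * R * R)%type.
Definition px (p : R3) : R := fst (fst p).
Definition py (p : R3) : R := snd (fst p).
Definition pt (p : R3) : R := snd p.

Definition nrm2 (x y : R) : R := sqrt (x * x + y * y).

(** r^a for r >= 0 and a > 0, with the convention 0^a = 0
    (Stdlib's Rpower 0 a is exp (a * ln 0) = 1, which is not what we want). *)
Definition powr (r a : R) : R := if Rle_dec r 0 then 0 else Rpower r a.

Fixpoint psum (f : nat -> R) (n : nat) : R :=
  match n with O => 0 | S k => psum f k + f k end.

Definition continuous2 (g : R -> R -> R) : Prop :=
  forall x y e, 0 < e -> exists eta, 0 < eta /\
    forall x' y', nrm2 (x' - x) (y' - y) < eta -> Rabs (g x' y' - g x y) < e.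

Definition is_dx (g h : R -> R -> R) : Prop :=
  forall x y, derivable_pt_lim (fun s => g s y) x (h x y).
Definition is_dy (g h : R -> R -> R) : Prop :=
  forall x y, derivable_pt_lim (fun s => g x s) y (h x y).

Inductive is_pd : nat -> (R -> R -> R) -> (R -> R -> R) -> Prop :=
  | pd0 f : is_pd 0 f f
  | pdx k f g h : is_pd k f g -> is_dx g h -> is_pd (S k) f h
  | pdy k f g h : is_pd k f g -> is_dy g h -> is_pd (S k) f h.

Definition smooth2 (f : R -> R -> R) : Prop :=
  forall k g, is_pd k f g ->
    continuous2 g /\ (exists h, is_dx g h) /\ (exists h, is_dy g h).

(** * Carnot-Caratheodory distance
    A horizontal curve gamma = (z, t) is determined by its planar projection
    z = (x,y) and t(0): t' = |z|^{2m} (y x' - x y'), and its length is the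
    Euclidean length of z.  We therefore describe admissible curves through
    their projection z : [0,1] -> R^2 (continuous, rectifiable), with the
    t-increment given by the line (Riemann-Stieltjes) integral of the
    1-form  |z|^{2m} (y dx - x dy)  along z. *)

Definition zx (w : R * R) : R := fst w.
Definition zy (w : R * R) : R := snd w.
Definition dist2 (a b : R * R) : R := nrm2 (zx a - zx b) (zy a - zy b).

Definition curve_cont (z : R -> R * R) : Prop :=
  forall s, 0 <= s <= 1 -> forall e, 0 < e -> exists eta, 0 < eta /\
    forall s', 0 <= s' <= 1 -> Rabs (s' - s) < eta -> dist2 (z s') (z s) < e.

Definition partition01 (n : nat) (s : nat -> R) : Prop :=
  s 0%nat = 0 /\ s n = 1 /\ (forall i, (i < n)%nat -> s i <= s (S i)).

Definition curve_len_le (z : R -> R * R) (L : R) : Prop :=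
  forall n s, partition01 n s ->
    psum (fun i => dist2 (z (s (S i))) (z (s i))) n <= L.

Definition formP (m x y : R) : R := powr (nrm2 x y) (2 * m) * y.
Definition formQ (m x y : R) : R := - (powr (nrm2 x y) (2 * m) * x).

Definition line_int (m : R) (z : R -> R * R) (I : R) : Prop :=
  forall e, 0 < e -> exists eta, 0 < eta /\
    forall n s tau,
      partition01 n s ->
      (forall i, (i < n)%nat -> s i <= tau i <= s (S i) /\ s (S i) - s i < eta) ->
      Rabs (psum (fun i =>
               formP m (zx (z (tau i))) (zy (z (tau i)))
                 * (zx (z (s (S i))) - zx (z (s i)))
             + formQ m (zx (z (tau i))) (zy (z (tau i)))
                 * (zy (z (s (S i))) - zy (z (s i)))) n - I) < e.

(** cc_lt m p q r  <->  d(p,q) < r   (there is a horizontal curve from p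
    to q of length < r). *)
Definition cc_lt (m : R) (p q : R3) (r : R) : Prop :=
  exists (z : R -> R * R) (L : R),
    L < r /\ curve_cont z /\
    z 0 = (px p, py p) /\ z 1 = (px q, py q) /\
    curve_len_le z L /\ line_int m z (pt q - pt p).

(** cc_gt m p q u  <->  d(p,q) > u   (i.e. not d(p,q) <= u) *)
Definition cc_gt (m : R) (p q : R3) (u : R) : Prop :=
  ~ (forall rho, u < rho -> cc_lt m p q rho).

Definition ball (m : R) (p : R3) (r : R) : R3 -> Prop := fun q => cc_lt m p q r.

Definition diam_gt (m : R) (gamma : R -> R3) (a b u : R) : Prop :=
  exists s1 s2, a <= s1 <= b /\ a <= s2 <= b /\ cc_gt m (gamma s1) (gamma s2) u.

(** diam(gamma|_[0,1]) <= K * d(p,q)   (K > 0), i.e.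
    d(gamma s1, gamma s2) <= K d(p,q) for all s1 s2 *)
Definition diam_le_mul_dist (m : R) (gamma : R -> R3) (K : R) (p q : R3) : Prop :=
  forall s1 s2, 0 <= s1 <= 1 -> 0 <= s2 <= 1 ->
    forall r, cc_lt m p q r -> cc_lt m (gamma s1) (gamma s2) (K * r).

Definition cc_continuous (m : R) (gamma : R -> R3) : Prop :=
  forall s, 0 <= s <= 1 -> forall e, 0 < e -> exists eta, 0 < eta /\
    forall s', 0 <= s' <= 1 -> Rabs (s' - s) < eta -> cc_lt m (gamma s) (gamma s') e.

(** B(gamma(t), eps * Delta_t) is contained in U, where
    Delta_t = min (diam gamma|[0,t], diam gamma|[t,1]).
    q is in that ball iff d(gamma t, q) < r for some r with
    r < eps*diam(gamma|[0,t]) and r < eps*diam(gamma|[t,1]). *)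
Definition ball_condition (m : R) (U : R3 -> Prop) (gamma : R -> R3)
    (eps t : R) : Prop :=
  forall q r, cc_lt m (gamma t) q r ->
    diam_gt m gamma 0 t (r / eps) -> diam_gt m gamma t 1 (r / eps) -> U q.

Definition uniform_domain (m : R) (U : R3 -> Prop) : Prop :=
  exists eps delta, 0 < eps /\ 0 < delta /\
    forall p q, U p -> U q ->
      exists gamma : R -> R3,
        (forall s, 0 <= s <= 1 -> U (gamma s)) /\
        gamma 0 = p /\ gamma 1 = q /\
        cc_continuous m gamma /\
        diam_le_mul_dist m gamma (/ delta) p q /\
        (forall t, 0 <= t <= 1 -> ball_condition m U gamma eps t).

Definition epi (phi : R -> R -> R) : R3 -> Prop :=
  fun p => pt p > phi (px p) (py p).

(* Main.v *)
(** In the coordinates (z, u) with u = t - phi(z) the epigraph is the half space u > 0,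
    which is invariant under translations in u, and horizontal curves satisfy
    u' = F(z) . z' with F = (Xu, Yu).  The hypothesis on the second derivatives gives
    |F(w) - F(z)| <~ |w - z| (|z| + |w - z|)^{2m}, so the ball B(p, r) is comparable to the
    box |dz| <= r, |du - F(z) . dz| <= r^2 (|z| + r)^{2m}.  One inclusion follows from the
    Lipschitz bound; for the other one, polar rectangles based at z enclose
    the required weighted area.

    From p = (z, u) one escapes the boundary along
    s |-> (z + s e, u + s |F(z)| + s^2 (|z| + s)^{2m}) with e the direction of F(z): at time s
    this curve is still in the box of size s about p, while its height dominates the
    oscillation of u over balls of size comparable to s.  Two such legs of length d(p, q),
    from p and from q, are joined by a straight segment in (z, u). *)

Require Import Defs.
From Stdlib Require Import Reals Lra Lia Classical FunctionalExtensionality.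
From Coquelicot Require Import Coquelicot.
Open Scope R_scope.

(** Why the escaping curve moves sideways: over a ball of radius comparable to s the height
    oscillates by about s |F(z)| + s^2 (|z| + s)^{2m}, so that much height must be gained at time s.
    A purely vertical rise can afford only the second term: rising by s |F(z)| above z leaves the
    box of size s as soon as |F(z)| is large against s (|z| + s)^{2m}. Moving by s e makes s |F(z)|
    exactly the height increment that F predicts, and only the second term is left as deviation.

    Diameters, not lengths, enter the definition of a uniform domain, so it suffices to know in
    which boxes the subarcs lie; the length of the joining curve is never estimated. The middle
    segment costs nothing extra: a box with fixed centre is convex in (z, u), and the oscillations
    at scale d(p, q) at the two ends are comparable. *)

(** * Euclidean norm and distance in the plane *)

Lemma nrm2_nonneg a b : 0 <= nrm2 a b.
Proof. apply sqrt_pos. Qed.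

Lemma nrm2_mul_self a b : nrm2 a b * nrm2 a b = a * a + b * b.
Proof. apply sqrt_sqrt; nra. Qed.

Lemma nrm2_le_of_sqr a b k : 0 <= k -> a * a + b * b <= k * k -> nrm2 a b <= k.
Proof.
  intros Hk H. generalize (nrm2_nonneg a b) (nrm2_mul_self a b). intros. nra.
Qed.

Lemma nrm2_ge_of_sqr a b k : k * k <= a * a + b * b -> k <= nrm2 a b.
Proof.
  intros H. generalize (nrm2_nonneg a b) (nrm2_mul_self a b). intros. nra.
Qed.

Lemma nrm2_scal k a b : nrm2 (k * a) (k * b) = Rabs k * nrm2 a b.
Proof.
  unfold nrm2. rewrite <- sqrt_Rsqr_abs, <- sqrt_mult_alt by apply Rle_0_sqr.
  f_equal. unfold Rsqr. ring.
Qed.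

Lemma nrm2_cauchy_schwarz a b c d : Rabs (a * c + b * d) <= nrm2 a b * nrm2 c d.
Proof.
  apply Rsqr_incr_0_var.
  - rewrite <- Rsqr_abs. unfold Rsqr.
    replace (nrm2 a b * nrm2 c d * (nrm2 a b * nrm2 c d))
      with ((nrm2 a b * nrm2 a b) * (nrm2 c d * nrm2 c d)) by ring.
    rewrite !nrm2_mul_self. generalize (Rle_0_sqr (a * d - b * c)). unfold Rsqr. nra.
  - apply Rmult_le_pos; apply nrm2_nonneg.
Qed.

Lemma nrm2_triangle a b c d : nrm2 (a + c) (b + d) <= nrm2 a b + nrm2 c d.
Proof.
  generalize (nrm2_nonneg a b) (nrm2_nonneg c d) (nrm2_mul_self a b)
    (nrm2_mul_self c d) (Rle_abs (a * c + b * d)) (nrm2_cauchy_schwarz a b c d).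
  intros. apply nrm2_le_of_sqr; nra.
Qed.

Lemma nrm2_opp a b : nrm2 (- a) (- b) = nrm2 a b.
Proof. unfold nrm2. f_equal. ring. Qed.

Lemma nrm2_sub_sym a b c d : nrm2 (a - c) (b - d) = nrm2 (c - a) (d - b).
Proof. rewrite <- nrm2_opp. f_equal; ring. Qed.

Lemma nrm2_zero : nrm2 0 0 = 0.
Proof. unfold nrm2. rewrite Rmult_0_l, Rplus_0_l. apply sqrt_0. Qed.

Lemma abs_le_nrm2_l a b : Rabs a <= nrm2 a b.
Proof.
  apply nrm2_ge_of_sqr. generalize (Rsqr_abs a). unfold Rsqr. nra.
Qed.

Lemma abs_le_nrm2_r a b : Rabs b <= nrm2 a b.
Proof.
  apply nrm2_ge_of_sqr. generalize (Rsqr_abs b). unfold Rsqr. nra.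
Qed.

Lemma nrm2_le_abs a b : nrm2 a b <= Rabs a + Rabs b.
Proof.
  generalize (Rabs_pos a) (Rabs_pos b) (Rsqr_abs a) (Rsqr_abs b). unfold Rsqr. intros.
  apply nrm2_le_of_sqr; nra.
Qed.

Lemma dist2_nonneg z w : 0 <= dist2 z w.
Proof. apply nrm2_nonneg. Qed.

Lemma dist2_sym z w : dist2 z w = dist2 w z.
Proof. apply nrm2_sub_sym. Qed.

Lemma dist2_refl z : dist2 z z = 0.
Proof. unfold dist2. rewrite !Rminus_diag. apply nrm2_zero. Qed.

Lemma dist2_triangle u v w : dist2 u w <= dist2 u v + dist2 v w.
Proof.
  unfold dist2. eapply Rle_trans; [|apply nrm2_triangle].
  right. f_equal; ring.
Qed.

Lemma nrm2_le_dist2 z w : nrm2 (zx w) (zy w) <= nrm2 (zx z) (zy z) + dist2 w z.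
Proof.
  unfold dist2. eapply Rle_trans; [|apply nrm2_triangle].
  right. f_equal; ring.
Qed.

(** * The weight r^n *)

Lemma powr_nonneg r n : 0 <= powr r n.
Proof. unfold powr. destruct Rle_dec; [lra | left; apply exp_pos]. Qed.

Lemma powr_pos r n : 0 < r -> 0 < powr r n.
Proof. intros H. unfold powr. destruct Rle_dec; [lra | apply exp_pos]. Qed.

Lemma powr_incr a b n : 0 <= n -> 0 <= a <= b -> powr a n <= powr b n.
Proof.
  intros Hn [Ha Hb]. unfold powr at 1. destruct Rle_dec; [apply powr_nonneg|].
  unfold powr. destruct Rle_dec; [lra|]. apply Rle_Rpower_l; lra.
Qed.

Lemma powr_mult a b n : 0 <= a -> 0 <= b -> powr (a * b) n = powr a n * powr b n.
Proof.
  intros Ha Hb. unfold powr.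
  destruct (Rle_dec a 0). { destruct Rle_dec; [ring | nra]. }
  destruct (Rle_dec b 0). { destruct Rle_dec; [ring | nra]. }
  destruct Rle_dec; [nra|]. rewrite Rpower_mult_distr; lra.
Qed.

(* With x = a/b <= 1: x^n = exp(n ln x) >= 1 - n(1/x - 1), and 1/x - 1 = (b - a)/a. *)
Lemma powr_sub_mul a b n :
  0 <= n -> 0 <= a <= b -> (powr b n - powr a n) * a <= n * (b - a) * powr b n.
Proof.
  intros Hn [Ha Hb]. destruct (Req_dec a 0) as [->|Ha0].
  { rewrite Rmult_0_r. apply Rmult_le_pos; [apply Rmult_le_pos; lra | apply powr_nonneg]. }
  assert (Hapos : 0 < a) by lra.
  assert (Hx : 0 < a / b) by (apply Rdiv_lt_0_compat; lra).
  assert (E : powr a n = powr b n * powr (a / b) n).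
  { rewrite <- powr_mult by lra. f_equal. field. lra. }
  assert (L : 1 - n * ((b - a) / a) <= powr (a / b) n).
  { unfold powr. destruct Rle_dec; [lra|]. unfold Rpower.
    eapply Rle_trans; [|apply exp_ineq1_le].
    assert (ln (b / a) <= (b - a) / a).
    { replace ((b - a) / a) with (b / a - 1) by (field; lra).
      assert (0 < b / a) by (apply Rdiv_lt_0_compat; lra).
      generalize (exp_ineq1_le (ln (b / a))). rewrite exp_ln by lra. lra. }
    replace (a / b) with (/ (b / a)) by (field; lra).
    rewrite ln_Rinv by (apply Rdiv_lt_0_compat; lra). nra. }
  rewrite E. generalize (powr_nonneg b n). intros HP.
  assert (powr b n * (1 - powr (a / b) n) * a <= powr b n * (n * ((b - a) / a)) * a).
  { apply Rmult_le_compat_r; [lra|]. apply Rmult_le_compat_l; lra. }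
  replace (powr b n * (n * ((b - a) / a)) * a) with (n * (b - a) * powr b n) in H
    by (field; lra).
  lra.
Qed.

(** Vertical size of the ball of radius r about a point at distance s from the t-axis. *)
Definition weight (m s r : R) : R := r * r * powr (s + r) (2 * m).

Lemma weight_nonneg m s r : 0 <= weight m s r.
Proof. apply Rmult_le_pos; [nra | apply powr_nonneg]. Qed.

Lemma weight_pos m s r : 0 <= s -> 0 < r -> 0 < weight m s r.
Proof. intros. apply Rmult_lt_0_compat; [nra | apply powr_pos; lra]. Qed.

Lemma weight_incr m s s' r r' :
  0 <= m -> 0 <= s -> 0 <= r <= r' -> s + r <= s' + r' -> weight m s r <= weight m s' r'.
Proof.
  intros. apply Rmult_le_compat; [nra | apply powr_nonneg | nra | apply powr_incr; lra].
Qed.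

(** * The contact form |z|^{2m} (y dx - x dy) at w, applied to (a, b) *)

Definition cform (m : R) (w : R * R) (a b : R) : R :=
  formP m (zx w) (zy w) * a + formQ m (zx w) (zy w) * b.

Lemma cform_eq m w a b :
  cform m w a b = powr (nrm2 (zx w) (zy w)) (2 * m) * (zy w * a - zx w * b).
Proof. unfold cform, formP, formQ. ring. Qed.

Lemma cross_le a b c d : Rabs (b * c - a * d) <= nrm2 a b * nrm2 c d.
Proof.
  replace (b * c - a * d) with (b * c + (- a) * d) by ring.
  replace (nrm2 a b) with (nrm2 b (- a)) by (unfold nrm2; f_equal; ring).
  apply nrm2_cauchy_schwarz.
Qed.

(** The difference splits into a change of the linear factor, weighted at the outer point [w'], and
    a change of the weight, multiplied by the linear factor at the inner point [w]. The second part
    carries the factor |w|, which is what [powr_sub_mul] needs; hence the ordering of the two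
    radii. *)
Lemma cform_lipschitz_aux m w w' M a b :
  0 <= m -> nrm2 (zx w) (zy w) <= nrm2 (zx w') (zy w') <= M ->
  Rabs (cform m w' a b - cform m w a b)
    <= (1 + 2 * m) * dist2 w' w * powr M (2 * m) * nrm2 a b.
Proof.
  intros Hm [H1 H2]. rewrite !cform_eq.
  generalize (nrm2_nonneg (zx w) (zy w)) (nrm2_nonneg a b) (dist2_nonneg w' w). intros N1 N2 N3.
  generalize (nrm2_le_dist2 w w'). intros D.
  set (r := nrm2 (zx w) (zy w)) in *. set (r' := nrm2 (zx w') (zy w')) in *.
  set (d := dist2 w' w) in *. set (v := nrm2 a b) in *.
  replace (powr r' (2 * m) * (zy w' * a - zx w' * b) - powr r (2 * m) * (zy w * a - zx w * b))
    with (powr r' (2 * m) * ((zy w' - zy w) * a - (zx w' - zx w) * b)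
          + (powr r' (2 * m) - powr r (2 * m)) * (zy w * a - zx w * b)) by ring.
  assert (C1 : Rabs ((zy w' - zy w) * a - (zx w' - zx w) * b) <= d * v) by apply cross_le.
  assert (C2 : Rabs (zy w * a - zx w * b) <= r * v) by apply cross_le.
  assert (P0 : 0 <= powr r' (2 * m)) by apply powr_nonneg.
  assert (P1 : powr r (2 * m) <= powr r' (2 * m)) by (apply powr_incr; lra).
  assert (P2 : powr r' (2 * m) <= powr M (2 * m)) by (apply powr_incr; lra).
  assert (P3 : (powr r' (2 * m) - powr r (2 * m)) * r <= 2 * m * (r' - r) * powr r' (2 * m))
    by (apply powr_sub_mul; lra).
  eapply Rle_trans; [apply Rabs_triang|]. rewrite !Rabs_mult.
  rewrite (Rabs_pos_eq (powr r' (2 * m))) by lra.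
  rewrite (Rabs_pos_eq (powr r' (2 * m) - powr r (2 * m))) by lra.
  assert (E1 : powr r' (2 * m) * Rabs ((zy w' - zy w) * a - (zx w' - zx w) * b)
                 <= powr M (2 * m) * (d * v)).
  { apply Rmult_le_compat; auto using Rabs_pos. }
  assert (E2 : (powr r' (2 * m) - powr r (2 * m)) * Rabs (zy w * a - zx w * b)
                 <= 2 * m * (d * powr M (2 * m)) * v).
  { apply Rle_trans with (((powr r' (2 * m) - powr r (2 * m)) * r) * v).
    - rewrite Rmult_assoc. apply Rmult_le_compat_l; lra.
    - apply Rmult_le_compat_r; [lra|]. eapply Rle_trans; [apply P3|].
      rewrite Rmult_assoc. apply Rmult_le_compat_l; [lra|].
      apply Rmult_le_compat; lra. }
  nra.
Qed.

Lemma cform_lipschitz m w w' M a b :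
  0 <= m -> nrm2 (zx w) (zy w) <= M -> nrm2 (zx w') (zy w') <= M ->
  Rabs (cform m w' a b - cform m w a b)
    <= (1 + 2 * m) * dist2 w' w * powr M (2 * m) * nrm2 a b.
Proof.
  intros Hm H1 H2.
  destruct (Rle_dec (nrm2 (zx w) (zy w)) (nrm2 (zx w') (zy w'))).
  - apply cform_lipschitz_aux; auto.
  - rewrite Rabs_minus_sym, dist2_sym. apply cform_lipschitz_aux; auto; lra.
Qed.

(** * Finite sums and partitions of [0, 1] *)

Lemma psum_le f g n : (forall i, (i < n)%nat -> f i <= g i) -> psum f n <= psum g n.
Proof.
  induction n; simpl; intros H; [lra|].
  apply Rplus_le_compat; [apply IHn; intros; apply H; lia | apply H; lia].
Qed.

Lemma psum_abs f n : Rabs (psum f n) <= psum (fun i => Rabs (f i)) n.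
Proof.
  induction n; simpl; [rewrite Rabs_R0; lra|].
  eapply Rle_trans; [apply Rabs_triang | lra].
Qed.

Lemma psum_scal k f n : psum (fun i => k * f i) n = k * psum f n.
Proof. induction n; simpl; [ring | rewrite IHn; ring]. Qed.

Lemma psum_minus f g n : psum (fun i => f i - g i) n = psum f n - psum g n.
Proof. induction n; simpl; [ring | rewrite IHn; ring]. Qed.

Lemma psum_telescope f n : psum (fun i => f (S i) - f i) n = f n - f 0%nat.
Proof. induction n; simpl; [ring | rewrite IHn; ring]. Qed.

Lemma partition01_range n s : partition01 n s -> forall i, (i <= n)%nat -> 0 <= s i <= 1.
Proof.
  intros (H0 & H1 & Hi).
  assert (A : forall i, (i <= n)%nat -> 0 <= s i).
  { induction i; intros; [lra|]. eapply Rle_trans; [apply IHi; lia | apply Hi; lia]. }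
  assert (B : forall k, (k <= n)%nat -> s (n - k)%nat <= 1).
  { induction k; intros; [rewrite Nat.sub_0_r; lra|].
    eapply Rle_trans; [apply Hi; lia|].
    replace (S (n - S k)) with (n - k)%nat by lia. apply IHk; lia. }
  intros i Hin. split; [auto|]. replace i with (n - (n - i))%nat by lia. apply B; lia.
Qed.

(** * The ball-box estimate: upper bounds on displacements *)

Lemma curve_len_dist z L s s' :
  curve_len_le z L -> 0 <= s <= s' -> s' <= 1 -> dist2 (z s') (z s) <= L.
Proof.
  intros H Hs Hs'.
  set (q := fun i => match i with O => 0 | 1%nat => s | 2%nat => s' | _ => 1 end).
  assert (P : partition01 3 q).
  { repeat split. intros i Hi. destruct i as [|[|[|i]]]; simpl; lra || lia. }
  specialize (H 3%nat q P). simpl in H.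
  generalize (dist2_nonneg (z s) (z 0)) (dist2_nonneg (z 1) (z s')). lra.
Qed.

Lemma uniform_partition N :
  (0 < N)%nat -> partition01 N (fun i => INR i / INR N).
Proof.
  intros HN. assert (0 < INR N) by (apply lt_0_INR; lia).
  split; [simpl; unfold Rdiv; ring|]. split; [field; lra|].
  intros i _. apply Rmult_le_compat_r; [left; apply Rinv_0_lt_compat; lra|].
  apply le_INR; lia.
Qed.

(** The line integral is compared with the sum in which the form is frozen at the starting point:
    that sum telescopes to [cform] of the total displacement. Freezing costs at most the Lipschitz
    constant times the distance from the start, at most [L], times the sum of the chords, again at
    most [L]; hence the quadratic weight. *)
Lemma cc_lt_displacement m p q r :
  0 <= m -> cc_lt m p q r ->
  0 < r /\ nrm2 (px q - px p) (py q - py p) <= r /\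
  Rabs (pt q - pt p - cform m (fst p) (px q - px p) (py q - py p))
    <= (1 + 2 * m) * weight m (nrm2 (px p) (py p)) r.
Proof.
  intros Hm (z & L & HL & Hc & Hz0 & Hz1 & Hlen & Hint).
  assert (D1 : dist2 (z 1) (z 0) <= L) by (apply curve_len_dist; auto; lra).
  assert (D0 := dist2_nonneg (z 1) (z 0)).
  assert (Ep : z 0 = fst p) by (rewrite Hz0; symmetry; apply surjective_pairing).
  assert (Eq : z 1 = fst q) by (rewrite Hz1; symmetry; apply surjective_pairing).
  split; [lra|]. split. { rewrite Ep, Eq in D1. unfold dist2, zx, zy in D1. unfold px, py. lra. }
  set (s0 := nrm2 (px p) (py p)). set (B := (1 + 2 * m) * L * powr (s0 + L) (2 * m)).
  assert (N0 : nrm2 (zx (z 0)) (zy (z 0)) = s0) by (rewrite Ep; reflexivity).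
  assert (S0 : 0 <= s0) by apply nrm2_nonneg.
  assert (BL : B * L <= (1 + 2 * m) * weight m s0 r).
  { replace (B * L) with ((1 + 2 * m) * weight m s0 L) by (unfold B, weight; ring).
    apply Rmult_le_compat_l; [lra|]. apply weight_incr; lra. }
  (* The slack [e] absorbs the error between the Riemann sum and the integral. *)
  apply le_epsilon. intros e He. eapply Rle_trans; [|apply Rplus_le_compat_r, BL].
  destruct (Hint e He) as (eta & Heta & Hsum).
  destruct (archimed_cor1 eta Heta) as (N & HN & HN0).
  specialize (Hsum N (fun i => INR i / INR N) (fun i => INR i / INR N) (uniform_partition N HN0)).
  assert (PN := partition01_range _ _ (uniform_partition N HN0)).
  assert (NP : 0 < INR N) by (apply lt_0_INR; lia).
  set (s := fun i => INR i / INR N) in *.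
  assert (Hst : forall i, (i < N)%nat -> s i <= s i <= s (S i) /\ s (S i) - s i < eta).
  { intros i _. unfold s. rewrite S_INR.
    replace ((INR i + 1) / INR N) with (INR i / INR N + / INR N) by (field; lra).
    assert (0 < / INR N) by (apply Rinv_0_lt_compat; lra). lra. }
  specialize (Hsum Hst).
  set (dx := fun i => zx (z (s (S i))) - zx (z (s i))) in *.
  set (dy := fun i => zy (z (s (S i))) - zy (z (s i))) in *.
  set (S1 := psum (fun i => cform m (z (s i)) (dx i) (dy i)) N).
  assert (E1 : Rabs (S1 - (pt q - pt p)) < e) by exact Hsum.
  set (S0' := psum (fun i => cform m (z 0) (dx i) (dy i)) N).
  assert (E0 : S0' = cform m (fst p) (px q - px p) (py q - py p)).
  { assert (s0E : s 0%nat = 0) by (unfold s; simpl; unfold Rdiv; ring).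
    assert (sNE : s N = 1) by (unfold s; field; lra).
    unfold S0', dx, dy.
    transitivity (psum (fun i => cform m (z 0) (zx (z (s (S i)))) (zy (z (s (S i))))
                                 - cform m (z 0) (zx (z (s i))) (zy (z (s i)))) N).
    { f_equal. apply functional_extensionality. intros i. unfold cform. ring. }
    rewrite (psum_telescope (fun i => cform m (z 0) (zx (z (s i))) (zy (z (s i))))).
    rewrite s0E, sNE, Ep, Eq. unfold cform, px, py, zx, zy. ring. }
  assert (E2 : Rabs (S1 - S0') <= B * L).
  { unfold S1, S0'. rewrite <- psum_minus. eapply Rle_trans; [apply psum_abs|].
    apply Rle_trans with (psum (fun i => B * dist2 (z (s (S i))) (z (s i))) N).
    - apply psum_le. intros i Hi.
      assert (R1 := PN i ltac:(lia)). fold s in R1.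
      assert (Di : dist2 (z (s i)) (z 0) <= L) by (apply curve_len_dist; auto; lra).
      eapply Rle_trans; [apply (cform_lipschitz m (z 0) (z (s i)) (s0 + L)); auto|].
      + lra.
      + generalize (nrm2_le_dist2 (z 0) (z (s i))). lra.
      + apply Rmult_le_compat_r; [apply nrm2_nonneg|]. unfold B.
        apply Rmult_le_compat_r; [apply powr_nonneg|]. apply Rmult_le_compat_l; lra.
    - rewrite psum_scal. apply Rmult_le_compat_l.
      + apply Rmult_le_pos; [nra | apply powr_nonneg].
      + apply Hlen. apply uniform_partition; auto. }
  rewrite <- E0. replace (pt q - pt p - S0') with ((S1 - S0') - (S1 - (pt q - pt p))) by ring.
  eapply Rle_trans; [apply Rabs_triang|]. rewrite Rabs_Ropp. lra.
Qed.

(** * Horizontal curves with Lipschitz projection *)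

(** The quadratic error bound on the lift T replaces the line integral: it passes to
    concatenations and telescopes over partitions. *)
Definition lift_reach (m : R) (z0 z1 : R * R) (h L : R) : Prop :=
  exists (z : R -> R * R) (T : R -> R) (K : R),
    z 0 = z0 /\ z 1 = z1 /\ T 1 - T 0 = h /\ 0 <= L /\ 0 <= K /\
    forall s s', 0 <= s <= s' -> s' <= 1 ->
      dist2 (z s') (z s) <= L * (s' - s) /\
      Rabs (T s' - T s - cform m (z s) (zx (z s') - zx (z s)) (zy (z s') - zy (z s)))
        <= K * (s' - s) * (s' - s).

Lemma lift_reach_cc m p q L r :
  0 <= m -> lift_reach m (fst p) (fst q) (pt q - pt p) L -> L < r -> cc_lt m p q r.
Proof.
  intros Hm (z & T & K & Hz0 & Hz1 & HT & HL & HK & Hloc) HLr.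
  assert (Hlip : forall s s', 0 <= s <= 1 -> 0 <= s' <= 1 -> dist2 (z s') (z s) <= L * Rabs (s' - s)).
  { intros s s' Hs Hs'. destruct (Rle_dec s s').
    - rewrite Rabs_pos_eq by lra. apply Hloc; lra.
    - rewrite dist2_sym, Rabs_minus_sym, Rabs_pos_eq by lra. apply Hloc; lra. }
  exists z, L. repeat split; auto.
  - intros s Hs e He. exists (e / (L + 1)). split; [apply Rdiv_lt_0_compat; lra|].
    intros s' Hs' Hd. eapply Rle_lt_trans; [apply Hlip; auto|].
    apply Rle_lt_trans with ((L + 1) * Rabs (s' - s)).
    + generalize (Rabs_pos (s' - s)). nra.
    + apply Rmult_lt_reg_l with (/ (L + 1)); [apply Rinv_0_lt_compat; lra|].
      rewrite <- Rmult_assoc, Rinv_l, Rmult_1_l by lra. unfold Rdiv in Hd. lra.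
  - rewrite Hz0. apply surjective_pairing.
  - rewrite Hz1. apply surjective_pairing.
  - intros n s Hp. assert (Rg := partition01_range _ _ Hp). destruct Hp as (P0 & P1 & P2).
    apply Rle_trans with (psum (fun i => L * (s (S i) - s i)) n).
    + apply psum_le. intros i Hi. apply Hloc; [split; [apply Rg; lia | auto] | apply Rg; lia].
    + rewrite psum_scal, (psum_telescope s), P0, P1. lra.
  - intros e He. set (s0 := nrm2 (zx (z 0)) (zy (z 0))).
    assert (S0 : 0 <= s0) by apply nrm2_nonneg.
    (* On an interval of length d the error is at most [B * d * d]: [K] for the lift, the rest for
       moving the evaluation point from [s i] to the tag. With mesh below e / (B + 1) the total is
       at most e minus the mesh bound, hence strictly below e. *)
    set (B := K + (1 + 2 * m) * L * powr (s0 + L) (2 * m) * L).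
    assert (HB : 0 <= B).
    { unfold B. generalize (powr_nonneg (s0 + L) (2 * m)). intros.
      apply Rplus_le_le_0_compat; auto. repeat apply Rmult_le_pos; lra. }
    exists (e / (B + 1)). split; [apply Rdiv_lt_0_compat; lra|].
    intros n s tau Hp Htau. assert (Rg := partition01_range _ _ Hp). destruct Hp as (P0 & P1 & P2).
    set (eta := e / (B + 1)) in *.
    rewrite <- HT.
    replace (T 1 - T 0) with (psum (fun i => T (s (S i)) - T (s i)) n)
      by (rewrite (psum_telescope (fun i => T (s i))), P0, P1; reflexivity).
    rewrite <- psum_minus. eapply Rle_lt_trans; [apply psum_abs|].
    apply Rle_lt_trans with (psum (fun i => B * eta * (s (S i) - s i)) n).
    + apply psum_le. intros i Hi.
      destruct (Htau i Hi) as ((T1 & T2) & T3).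
      assert (R1 := Rg i ltac:(lia)). assert (R2 := Rg (S i) ltac:(lia)).
      set (dx := zx (z (s (S i))) - zx (z (s i))). set (dy := zy (z (s (S i))) - zy (z (s i))).
      destruct (Hloc (s i) (s (S i)) ltac:(lra) ltac:(lra)) as (L1 & L2). fold dx dy in L2.
      assert (M : forall t, 0 <= t <= 1 -> nrm2 (zx (z t)) (zy (z t)) <= s0 + L).
      { intros t Ht. eapply Rle_trans; [apply (nrm2_le_dist2 (z 0))|]. fold s0.
        generalize (Hlip 0 t ltac:(lra) Ht). rewrite Rabs_pos_eq by lra.
        generalize (Rmult_le_compat_l L (t - 0) 1 HL ltac:(lra)). lra. }
      assert (L3 := cform_lipschitz m (z (s i)) (z (tau i)) (s0 + L) dx dy Hm
                      (M _ R1) (M (tau i) ltac:(lra))).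
      assert (L4 : dist2 (z (tau i)) (z (s i)) <= L * (s (S i) - s i)).
      { eapply Rle_trans; [apply Hloc; lra|]. apply Rmult_le_compat_l; lra. }
      set (d := s (S i) - s i) in *. assert (Hd : 0 <= d) by (unfold d; lra).
      assert (L5 : (1 + 2 * m) * dist2 (z (tau i)) (z (s i)) * powr (s0 + L) (2 * m) * nrm2 dx dy
                   <= (1 + 2 * m) * (L * d) * powr (s0 + L) (2 * m) * (L * d)).
      { generalize (powr_nonneg (s0 + L) (2 * m)) (dist2_nonneg (z (tau i)) (z (s i))). intros.
        apply Rmult_le_compat; [| apply nrm2_nonneg | | exact L1].
        - repeat apply Rmult_le_pos; lra.
        - apply Rmult_le_compat_r; [lra|]. apply Rmult_le_compat_l; lra. }
      match goal with |- Rabs (?a - ?b) <= _ =>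
        replace (a - b) with ((cform m (z (tau i)) dx dy - cform m (z (s i)) dx dy)
          - (T (s (S i)) - T (s i) - cform m (z (s i)) dx dy)) by (unfold cform, dx, dy; ring) end.
      eapply Rle_trans; [apply Rabs_triang|]. rewrite Rabs_Ropp.
      apply Rle_trans with (B * d * d). { unfold B. lra. }
      rewrite !Rmult_assoc. apply Rmult_le_compat_l; [lra|]. apply Rmult_le_compat_r; lra.
    + rewrite psum_scal, (psum_telescope s), P0, P1.
      replace (B * eta * (1 - 0)) with (e - eta) by (unfold eta; field; lra).
      assert (0 < eta) by (apply Rdiv_lt_0_compat; lra). lra.
Qed.

Lemma cform_add m w a b a' b' : cform m w (a + a') (b + b') = cform m w a b + cform m w a' b'.
Proof. unfold cform. ring. Qed.

Lemma lift_reach_weaken m z0 z1 h L L' :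
  L <= L' -> lift_reach m z0 z1 h L -> lift_reach m z0 z1 h L'.
Proof.
  intros HL (z & T & K & H0 & H1 & HT & HLp & HK & H). exists z, T, K.
  repeat split; auto; [lra | | apply H; auto].
  eapply Rle_trans; [apply H; auto|]. apply Rmult_le_compat_r; lra.
Qed.

(** Each curve is run at double speed on its half of [0, 1], which gives the factor 2 in the length
    and 4 in the quadratic errors. Only intervals straddling 1/2 need care: there the second
    increment is measured with the form at [z s] instead of at the junction, and the Lipschitz bound
    makes this change quadratic too, with constant [K3]. *)
Lemma lift_reach_trans m z0 z1 z2 h1 h2 L1 L2 :
  0 <= m -> lift_reach m z0 z1 h1 L1 -> lift_reach m z1 z2 h2 L2 ->
  lift_reach m z0 z2 (h1 + h2) (2 * (L1 + L2)).
Proof.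
  intros Hm (za & Ta & Ka & Ha0 & Ha1 & HTa & HLa & HKa & Ha)
            (zb & Tb & Kb & Hb0 & Hb1 & HTb & HLb & HKb & Hb).
  set (L := L1 + L2).
  set (z := fun s => if Rle_dec s (/2) then za (2 * s) else zb (2 * s - 1)).
  set (T := fun s => if Rle_dec s (/2) then Ta (2 * s) else Tb (2 * s - 1) + (Ta 1 - Tb 0)).
  assert (z_l : forall s, s <= /2 -> z s = za (2 * s)).
  { intros s Hs. unfold z. destruct Rle_dec; [reflexivity | lra]. }
  assert (T_l : forall s, s <= /2 -> T s = Ta (2 * s)).
  { intros s Hs. unfold T. destruct Rle_dec; [reflexivity | lra]. }
  assert (z_r : forall s, /2 <= s -> z s = zb (2 * s - 1)).
  { intros s Hs. unfold z. destruct Rle_dec; [|reflexivity].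
    replace s with (/2) by lra. replace (2 * /2) with 1 by field.
    rewrite Ha1, Rminus_diag. auto. }
  assert (T_r : forall s, /2 <= s -> T s = Tb (2 * s - 1) + (Ta 1 - Tb 0)).
  { intros s Hs. unfold T. destruct Rle_dec; [|reflexivity].
    replace s with (/2) by lra. replace (2 * /2) with 1 by field.
    rewrite Rminus_diag. ring. }
  set (P := fun K s s' => dist2 (z s') (z s) <= 2 * L * (s' - s) /\
      Rabs (T s' - T s - cform m (z s) (zx (z s') - zx (z s)) (zy (z s') - zy (z s)))
        <= K * (s' - s) * (s' - s)).
  assert (PL : forall s s', 0 <= s <= s' -> s' <= /2 -> P (4 * Ka) s s').
  { intros s s' Hs Hs'. unfold P. rewrite !z_l, !T_l by lra.
    destruct (Ha (2 * s) (2 * s') ltac:(lra) ltac:(lra)) as [A1 A2]. split.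
    - eapply Rle_trans; [apply A1|]. unfold L. nra.
    - eapply Rle_trans; [apply A2|]. right; ring. }
  assert (PR : forall s s', /2 <= s <= s' -> s' <= 1 -> P (4 * Kb) s s').
  { intros s s' Hs Hs'. unfold P. rewrite !z_r, !T_r by lra.
    destruct (Hb (2 * s - 1) (2 * s' - 1) ltac:(lra) ltac:(lra)) as [A1 A2]. split.
    - eapply Rle_trans; [apply A1|]. unfold L. nra.
    - match goal with |- Rabs ?a <= _ => match type of A2 with Rabs ?b <= _ =>
        replace a with b by ring end end.
      eapply Rle_trans; [apply A2|]. right; ring. }
  set (s0 := nrm2 (zx (z (/2))) (zy (z (/2)))).
  set (K3 := (1 + 2 * m) * (2 * L) * powr (s0 + 2 * L) (2 * m) * (2 * L)).
  assert (HL : 0 <= L) by (unfold L; lra).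
  assert (HK3 : 0 <= K3).
  { generalize (powr_nonneg (s0 + 2 * L) (2 * m)). intros. repeat apply Rmult_le_pos; lra. }
  exists z, T, (4 * Ka + 4 * Kb + K3).
  refine (conj _ (conj _ (conj _ (conj _ (conj _ _))))); try lra.
  { rewrite z_l, Rmult_0_r by lra. auto. }
  { rewrite z_r by lra. replace (2 * 1 - 1) with 1 by ring. auto. }
  { rewrite T_r, T_l by lra. rewrite Rmult_0_r. replace (2 * 1 - 1) with 1 by ring. lra. }
  intros s s' Hs Hs'. change (P (4 * Ka + 4 * Kb + K3) s s').
  assert (Pmono : forall K, 0 <= K <= 4 * Ka + 4 * Kb + K3 -> P K s s' -> P (4 * Ka + 4 * Kb + K3) s s').
  { intros K HK [A1 A2]. split; auto. eapply Rle_trans; [apply A2|].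
    apply Rmult_le_compat_r; [lra|]. apply Rmult_le_compat_r; lra. }
  destruct (Rle_dec s' (/2)). { apply (Pmono (4 * Ka)); [lra | apply PL; lra]. }
  destruct (Rle_dec (/2) s). { apply (Pmono (4 * Kb)); [lra | apply PR; lra]. }
  destruct (PL s (/2) ltac:(lra) ltac:(lra)) as [A1 A2].
  destruct (PR (/2) s' ltac:(lra) ltac:(lra)) as [B1 B2].
  split.
  { generalize (dist2_triangle (z s') (z (/2)) (z s)). lra. }
  set (dx := zx (z s') - zx (z (/2))) in *. set (dy := zy (z s') - zy (z (/2))) in *.
  set (ex := zx (z (/2)) - zx (z s)) in *. set (ey := zy (z (/2)) - zy (z s)) in *.
  replace (zx (z s') - zx (z s)) with (dx + ex) by (unfold dx, ex; ring).
  replace (zy (z s') - zy (z s)) with (dy + ey) by (unfold dy, ey; ring).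
  rewrite cform_add.
  assert (C : Rabs (cform m (z (/2)) dx dy - cform m (z s) dx dy) <= K3 * (s' - s) * (s' - s)).
  { assert (D : dist2 (z (/2)) (z s) <= 2 * L * (s' - s)).
    { eapply Rle_trans; [apply A1|]. apply Rmult_le_compat_l; lra. }
    assert (D' : dist2 (z s') (z (/2)) <= 2 * L * (s' - s)).
    { eapply Rle_trans; [apply B1|]. apply Rmult_le_compat_l; lra. }
    eapply Rle_trans; [apply (cform_lipschitz m (z s) (z (/2)) (s0 + 2 * L)); auto|].
    - eapply Rle_trans; [apply (nrm2_le_dist2 (z (/2)))|]. fold s0. rewrite dist2_sym. nra.
    - fold s0. lra.
    - generalize (powr_nonneg (s0 + 2 * L) (2 * m)) (dist2_nonneg (z (/2)) (z s)). intros.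
      replace (K3 * (s' - s) * (s' - s)) with
        ((1 + 2 * m) * (2 * L * (s' - s)) * powr (s0 + 2 * L) (2 * m) * (2 * L * (s' - s)))
        by (unfold K3; ring).
      apply Rmult_le_compat; [| apply nrm2_nonneg | | exact D'].
      + repeat apply Rmult_le_pos; lra.
      + apply Rmult_le_compat_r; [lra|]. apply Rmult_le_compat_l; lra. }
  replace (T s' - T s - (cform m (z s) dx dy + cform m (z s) ex ey)) with
    ((T s' - T (/2) - cform m (z (/2)) dx dy) + (T (/2) - T s - cform m (z s) ex ey)
     + (cform m (z (/2)) dx dy - cform m (z s) dx dy)) by ring.
  eapply Rle_trans; [apply Rabs_triang|]. eapply Rle_trans; [apply Rplus_le_compat_r, Rabs_triang|].
  assert (B2' : 4 * Kb * (s' - /2) * (s' - /2) <= 4 * Kb * (s' - s) * (s' - s)).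
  { apply Rmult_le_compat; try lra; [apply Rmult_le_pos; lra | apply Rmult_le_compat_l; lra]. }
  assert (A2' : 4 * Ka * (/2 - s) * (/2 - s) <= 4 * Ka * (s' - s) * (s' - s)).
  { apply Rmult_le_compat; try lra; [apply Rmult_le_pos; lra | apply Rmult_le_compat_l; lra]. }
  lra.
Qed.

(** * Elementary horizontal curves: segments, rays, circular arcs and loops *)

(** Extends functions on [0, 1] by constants, so that continuity and differentiability can be stated
    on the whole line; it also builds the piecewise parameters of the final curve. *)
Definition clamp (t : R) : R := Rmax 0 (Rmin t 1).

Lemma clamp_range t : 0 <= clamp t <= 1.
Proof.
  unfold clamp. generalize (Rmax_l 0 (Rmin t 1)) (Rmin_r t 1). intros. split; auto.
  apply Rmax_lub; lra.
Qed.

Lemma clamp_lipschitz t t' : Rabs (clamp t' - clamp t) <= Rabs (t' - t).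
Proof.
  unfold clamp, Rmax, Rmin. repeat destruct Rle_dec; unfold Rabs; repeat destruct Rcase_abs; lra.
Qed.

Lemma clamp_id t : 0 <= t <= 1 -> clamp t = t.
Proof. intros. unfold clamp. rewrite Rmin_left, Rmax_right; lra. Qed.

Lemma clamp_le_0 t : t <= 0 -> clamp t = 0.
Proof. intros. unfold clamp. rewrite Rmin_left, Rmax_left; lra. Qed.

Lemma clamp_ge_1 t : 1 <= t -> clamp t = 1.
Proof. intros. unfold clamp. rewrite Rmin_right, Rmax_right; lra. Qed.

Lemma lipschitz_continuity_pt f k s :
  0 <= k -> (forall s', Rabs (f s' - f s) <= k * Rabs (s' - s)) -> continuity_pt f s.
Proof.
  intros Hk H e He. exists (e / (k + 1)). split; [apply Rdiv_lt_0_compat; lra|].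
  intros s' [_ Hd]. unfold dist in *; simpl in *; unfold R_dist in *.
  eapply Rle_lt_trans; [apply H|].
  apply Rle_lt_trans with ((k + 1) * Rabs (s' - s)).
  - generalize (Rabs_pos (s' - s)). nra.
  - apply Rmult_lt_reg_l with (/ (k + 1)); [apply Rinv_0_lt_compat; lra|].
    rewrite <- Rmult_assoc, Rinv_l, Rmult_1_l by lra. unfold Rdiv in Hd. lra.
Qed.

(* Along the segment y dx - x dy is the constant k, so the lift is k times a primitive
   of the weight. *)
Lemma lift_reach_segment m z0 z1 :
  0 <= m -> exists h, lift_reach m z0 z1 h (dist2 z1 z0).
Proof.
  intros Hm. set (L := dist2 z1 z0). assert (HL : 0 <= L) by apply dist2_nonneg.
  set (dx := zx z1 - zx z0). set (dy := zy z1 - zy z0).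
  set (z := fun s => (zx z0 + s * dx, zy z0 + s * dy)).
  set (s0 := nrm2 (zx z0) (zy z0)). assert (S0 : 0 <= s0) by apply nrm2_nonneg.
  set (B := (1 + 2 * m) * L * powr (s0 + L) (2 * m) * L).
  set (f := fun s => cform m (z (clamp s)) dx dy).
  assert (Dz : forall s s', dist2 (z s') (z s) = L * Rabs (s' - s)).
  { intros s s'. rewrite Rmult_comm. unfold L, dist2. rewrite <- nrm2_scal.
    unfold z; f_equal; unfold dx, dy; simpl; ring. }
  assert (Mz : forall s, 0 <= s <= 1 -> nrm2 (zx (z s)) (zy (z s)) <= s0 + L).
  { intros s Hs. eapply Rle_trans; [apply (nrm2_le_dist2 (z 0))|].
    rewrite Dz, Rabs_pos_eq by lra. replace (z 0) with z0.
    - fold s0. nra.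
    - unfold z. rewrite !Rmult_0_l, !Rplus_0_r. apply surjective_pairing. }
  assert (HB : 0 <= B).
  { generalize (powr_nonneg (s0 + L) (2 * m)). intros. repeat apply Rmult_le_pos; lra. }
  assert (f_lip : forall s s', Rabs (f s' - f s) <= B * Rabs (s' - s)).
  { intros s s'. unfold f.
    eapply Rle_trans; [apply (cform_lipschitz m _ _ (s0 + L)); auto using clamp_range|].
    rewrite Dz. replace (nrm2 dx dy) with L by reflexivity.
    unfold B. generalize (powr_nonneg (s0 + L) (2 * m)). intros.
    replace ((1 + 2 * m) * L * powr (s0 + L) (2 * m) * L * Rabs (s' - s)) with
      ((1 + 2 * m) * (L * Rabs (s' - s)) * powr (s0 + L) (2 * m) * L) by ring.
    apply Rmult_le_compat_r; auto. apply Rmult_le_compat_r; auto.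
    apply Rmult_le_compat_l; [lra|]. apply Rmult_le_compat_l; auto using clamp_lipschitz. }
  assert (f_cont : forall s, continuity_pt f s).
  { intros s. apply lipschitz_continuity_pt with B; auto. }
  set (T := fun s => RInt f 0 s).
  assert (HT : forall s, is_derive T s (f s)).
  { intros s. apply (is_derive_RInt f T 0).
    - apply filter_forall. intros b. apply (RInt_correct f), (ex_RInt_continuous (V := R_CompleteNormedModule)).
      intros t _. apply continuity_pt_filterlim, f_cont.
    - apply continuity_pt_filterlim, f_cont. }
  exists (T 1 - T 0), z, T, B. repeat split; auto.
  - unfold z. rewrite !Rmult_0_l, !Rplus_0_r. symmetry. apply surjective_pairing.
  - unfold z, dx, dy. rewrite !Rmult_1_l, !Rplus_minus. symmetry. apply surjective_pairing.
  - rewrite Dz, Rabs_pos_eq; lra.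
  (* The increment of [T] is [f c * (s' - s)] and the form at [z s] gives [f s * (s' - s)]; the
     Lipschitz bound on [f] makes the difference quadratic. *)
  - destruct (MVT_gen T s s' f) as (c & Hc & E).
    { intros; apply HT. }
    { intros. apply derivable_continuous_pt. exists (f x). apply is_derive_Reals, HT. }
    rewrite Rmin_left, Rmax_right in Hc by lra.
    rewrite E.
    replace (cform m (z s) (zx (z s') - zx (z s)) (zy (z s') - zy (z s)))
      with (f s * (s' - s)).
    + rewrite <- Rmult_minus_distr_r, Rabs_mult, (Rabs_pos_eq (s' - s)) by lra.
      apply Rmult_le_compat_r; [lra|]. eapply Rle_trans; [apply f_lip|].
      apply Rmult_le_compat_l; auto. rewrite Rabs_pos_eq; lra.
    + unfold f. rewrite clamp_id by lra. unfold cform, z. simpl. ring.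
Qed.

(** The form y dx - x dy vanishes along lines through the origin, so the lift is constant. *)
Lemma lift_reach_radial m ex ey a b :
  nrm2 ex ey = 1 -> lift_reach m (a * ex, a * ey) (b * ex, b * ey) 0 (Rabs (b - a)).
Proof.
  intros He. set (z := fun s => ((a + s * (b - a)) * ex, (a + s * (b - a)) * ey)).
  exists z, (fun _ => 0), 0. repeat split; try lra; try apply Rabs_pos.
  - unfold z. f_equal; ring.
  - unfold z. f_equal; ring.
  - unfold dist2, z; simpl.
    replace (_ - _) with ((b - a) * (s' - s) * ex) by ring.
    replace ((a + s' * (b - a)) * ey - (a + s * (b - a)) * ey) with ((b - a) * (s' - s) * ey) by ring.
    rewrite nrm2_scal, He, Rabs_mult, (Rabs_pos_eq (s' - s)); lra.
  - rewrite cform_eq. unfold z; simpl.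
    replace (_ - _ - _) with 0 by ring. rewrite Rabs_R0. lra.
Qed.

(** Two mean values give sin t - t = - sin c' * c * t with |c| <= |t|. The quadratic order is all
    that [lift_reach] asks of the arc. *)
Lemma sin_sub_le t : Rabs (sin t - t) <= t * t.
Proof.
  destruct (MVT_gen (fun x => sin x - x) 0 t (fun x => cos x - 1)) as (c & Hc & E).
  { intros. auto_derive; auto; ring. }
  { intros. apply derivable_continuous_pt. reg. }
  destruct (MVT_gen cos 0 c (fun x => - sin x)) as (c' & _ & E').
  { intros. auto_derive; auto; ring. }
  { intros. apply derivable_continuous_pt. reg. }
  rewrite sin_0, !Rminus_0_r in E. rewrite cos_0, Rminus_0_r in E'.
  rewrite E, E', Rabs_mult, Rabs_mult, Rabs_Ropp.
  assert (Rabs (sin c') <= 1) by (apply Rabs_le; apply SIN_bound).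
  assert (Rabs c <= Rabs t).
  { unfold Rmin, Rmax in Hc. destruct Rle_dec; unfold Rabs; repeat destruct Rcase_abs; lra. }
  generalize (Rabs_pos (sin c')) (Rabs_pos c) (Rabs_pos t) (Rsqr_abs t). unfold Rsqr. intros.
  replace (t * t) with (Rabs t * Rabs t) by lra.
  apply Rmult_le_compat_r; auto. nra.
Qed.

Lemma chord_le t t' : nrm2 (cos t' - cos t) (sin t' - sin t) <= Rabs (t' - t).
Proof.
  apply nrm2_le_of_sqr; [apply Rabs_pos|].
  generalize (Rsqr_abs (t' - t)). unfold Rsqr. intros <-.
  assert (E : (cos t' - cos t) * (cos t' - cos t) + (sin t' - sin t) * (sin t' - sin t)
              = 2 - 2 * cos (t' - t)).
  { rewrite cos_minus. generalize (sin2_cos2 t) (sin2_cos2 t'). unfold Rsqr. lra. }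
  rewrite E. set (u := t' - t).
  replace u with (2 * (u / 2)) at 1 by field. rewrite cos_2a_sin.
  generalize (Rsqr_abs (sin (u / 2))) (Rabs_pos (sin (u/2))) (Rsqr_abs (u / 2)). unfold Rsqr. intros.
  assert (Rabs (sin (u / 2)) <= Rabs (u / 2)).
  { destruct (MVT_gen sin 0 (u/2) cos) as (c & Hc & Em).
    { intros. auto_derive; auto; ring. }
    { intros. apply derivable_continuous_pt. reg. }
    rewrite sin_0, !Rminus_0_r in Em. rewrite Em, Rabs_mult.
    assert (Rabs (cos c) <= 1) by (apply Rabs_le; apply COS_bound).
    generalize (Rabs_pos (u/2)). nra. }
  nra.
Qed.

Definition rot (t ex ey : R) : R * R := (cos t * ex - sin t * ey, sin t * ex + cos t * ey).

(** On the circle of radius a the form is - a^2 a^{2m} d(theta), so the lift is linear in the angle.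
    Over an angle u the form frozen at the start gives - w sin u against - w u, and the error is w
    (sin u - u). *)
Lemma lift_reach_arc m a ex ey t :
  0 <= a -> nrm2 ex ey = 1 ->
  lift_reach m (a * ex, a * ey) (a * zx (rot t ex ey), a * zy (rot t ex ey))
    (- (t * (a * a * powr a (2 * m)))) (a * Rabs t).
Proof.
  intros Ha He.
  assert (He2 : ex * ex + ey * ey = 1) by (rewrite <- nrm2_mul_self, He; ring).
  set (z := fun s => (a * zx (rot (s * t) ex ey), a * zy (rot (s * t) ex ey))).
  set (w := a * a * powr a (2 * m)).
  assert (Hw : 0 <= w) by (apply Rmult_le_pos; [nra | apply powr_nonneg]).
  exists z, (fun s => - (s * t * w)), (w * (t * t)).
  repeat split; try lra.
  - unfold z, rot; simpl. rewrite Rmult_0_l, cos_0, sin_0. f_equal; ring.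
  - unfold z. rewrite Rmult_1_l. reflexivity.
  - apply Rmult_le_pos; [auto | apply Rabs_pos].
  - apply Rmult_le_pos; nra.
  - set (c := cos (s' * t) - cos (s * t)). set (d := sin (s' * t) - sin (s * t)).
    assert (E : dist2 (z s') (z s) = a * nrm2 c d).
    { unfold dist2. apply Rle_antisym.
      - apply nrm2_le_of_sqr; [apply Rmult_le_pos; [auto | apply nrm2_nonneg]|].
        replace (a * nrm2 c d * (a * nrm2 c d)) with (a * a * (nrm2 c d * nrm2 c d)) by ring.
        rewrite nrm2_mul_self. right. unfold z, rot, c, d; simpl.
        rewrite <- (Rmult_1_r (a * a * _)), <- He2. ring.
      - apply nrm2_ge_of_sqr.
        replace (a * nrm2 c d * (a * nrm2 c d)) with (a * a * (nrm2 c d * nrm2 c d)) by ring.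
        rewrite nrm2_mul_self. right. unfold z, rot, c, d; simpl.
        rewrite <- (Rmult_1_r (a * a * _)), <- He2. ring. }
    rewrite E. eapply Rle_trans; [apply Rmult_le_compat_l; [auto | apply chord_le]|].
    replace (s' * t - s * t) with (t * (s' - s)) by ring.
    rewrite Rabs_mult, (Rabs_pos_eq (s' - s)) by lra. right; ring.
  - rewrite cform_eq.
    assert (N : nrm2 (zx (z s)) (zy (z s)) = a).
    { unfold z, rot; simpl. rewrite nrm2_scal, Rabs_pos_eq by auto.
      replace (nrm2 _ _) with 1; [ring|]. symmetry.
      rewrite <- sqrt_1. unfold nrm2. f_equal. rewrite <- He2.
      generalize (sin2_cos2 (s * t)). unfold Rsqr. intros Hsc.
      transitivity ((sin (s * t) * sin (s * t) + cos (s * t) * cos (s * t)) * (ex * ex + ey * ey)); [ring|].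
      rewrite Hsc. ring. }
    rewrite N. set (u := (s' - s) * t).
    assert (Su : sin u = sin (s' * t) * cos (s * t) - cos (s' * t) * sin (s * t)).
    { unfold u. rewrite Rmult_minus_distr_r. apply sin_minus. }
    replace (_ - _) with (w * (sin u - u)).
    + rewrite Rabs_mult, (Rabs_pos_eq w) by auto.
      replace (w * (t * t) * (s' - s) * (s' - s)) with (w * (u * u)) by (unfold u; ring).
      apply Rmult_le_compat_l; auto. apply sin_sub_le.
    + rewrite Su. unfold z, rot, w, u; simpl.
      transitivity (powr a (2 * m) * (a * a) *
        ((sin (s' * t) * cos (s * t) - cos (s' * t) * sin (s * t)) * (ex * ex + ey * ey)
         - (s' - s) * t)); [rewrite He2; ring | ring].
Qed.

Lemma unit_direction (z : R * R) :
  exists ex ey, nrm2 ex ey = 1 /\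
    z = (nrm2 (zx z) (zy z) * ex, nrm2 (zx z) (zy z) * ey).
Proof.
  destruct z as [x y]; simpl. set (s := nrm2 x y).
  assert (Hs : 0 <= s) by apply nrm2_nonneg.
  destruct (Req_dec s 0) as [E|E].
  (* At the origin any unit vector serves. *)
  - exists 1, 0. generalize (abs_le_nrm2_l x y) (abs_le_nrm2_r x y). fold s. rewrite E. intros.
    split.
    + unfold nrm2. rewrite Rmult_0_l, Rplus_0_r, Rmult_1_r. apply sqrt_1.
    + generalize (Rabs_pos x) (Rabs_pos y) (Rle_abs x) (Rle_abs y) (Rle_abs (- x)) (Rle_abs (- y)).
      rewrite !Rabs_Ropp. intros. f_equal; lra.
  - exists (x / s), (y / s). split.
    + replace (x / s) with (/ s * x) by (field; auto).
      replace (y / s) with (/ s * y) by (field; auto).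
      rewrite nrm2_scal. fold s. rewrite Rabs_pos_eq; [field; auto|].
      left. apply Rinv_0_lt_compat. lra.
    + f_equal; field; auto.
Qed.

(* The loop runs around the polar rectangle [|z|, |z|+r] x [0, t]; the angle t is chosen so
   that the lift, which only moves along the two arcs, rises exactly by h. *)
Lemma lift_reach_loop m z r h B :
  0 <= m -> 0 < r -> 0 <= B -> Rabs h <= B * weight m (nrm2 (zx z) (zy z)) r ->
  lift_reach m z z h (8 * (1 + B) * r).
Proof.
  intros Hm Hr HB Hh. destruct (unit_direction z) as (ex & ey & He & Ez).
  set (s := nrm2 (zx z) (zy z)) in *. assert (Hs : 0 <= s) by apply nrm2_nonneg.
  set (w := (s + r) * (s + r) * powr (s + r) (2 * m)). set (w' := s * s * powr s (2 * m)).
  assert (Pw : 0 < powr (s + r) (2 * m)) by (apply powr_pos; lra).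
  (* [w - w'] is the height gained per unit of angle, up to sign. This lower bound keeps the angle
     below B r / (s + r), so that even the outer arc is no longer than B r. *)
  assert (D : r * (s + r) * powr (s + r) (2 * m) <= w - w').
  { assert (w' <= s * (s + r) * powr (s + r) (2 * m)).
    { unfold w'. apply Rmult_le_compat; [nra | apply powr_nonneg | nra | apply powr_incr; lra]. }
    unfold w. lra. }
  assert (Dp : 0 < w - w').
  { eapply Rlt_le_trans; [|apply D]. repeat apply Rmult_lt_0_compat; lra. }
  set (t := - h / (w - w')).
  assert (Ht : (s + r) * Rabs t <= B * r).
  { assert (E : Rabs t * (w - w') = Rabs h).
    { unfold t, Rdiv. rewrite Rabs_mult, Rabs_Ropp, Rabs_inv, (Rabs_pos_eq (w - w')) by lra.
      field. lra. }
    apply Rmult_le_reg_r with (r * powr (s + r) (2 * m)).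
    { apply Rmult_lt_0_compat; lra. }
    replace (B * r * (r * powr (s + r) (2 * m))) with (B * weight m s r) by (unfold weight; ring).
    eapply Rle_trans; [|apply Hh]. rewrite <- E.
    eapply Rle_trans; [|apply Rmult_le_compat_l, D; apply Rabs_pos]. right; ring. }
  set (e' := rot t ex ey).
  assert (He' : nrm2 (zx e') (zy e') = 1).
  { rewrite <- sqrt_1. unfold nrm2. f_equal.
    transitivity ((sin t * sin t + cos t * cos t) * (ex * ex + ey * ey)).
    - unfold e', rot; simpl; ring.
    - rewrite <- (nrm2_mul_self ex ey), He. generalize (sin2_cos2 t). unfold Rsqr. intros ->. ring. }
  assert (Back : rot (- t) (zx e') (zy e') = (ex, ey)).
  { unfold rot at 1, e', rot; simpl. rewrite cos_neg, sin_neg.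
    generalize (sin2_cos2 t). unfold Rsqr. intros H.
    f_equal.
    - transitivity ((sin t * sin t + cos t * cos t) * ex); [ring | rewrite H; ring].
    - transitivity ((sin t * sin t + cos t * cos t) * ey); [ring | rewrite H; ring]. }
  assert (G1 := lift_reach_radial m ex ey s (s + r) He).
  assert (G2 := lift_reach_arc m (s + r) ex ey t ltac:(lra) He). fold e' in G2.
  assert (G3 := lift_reach_radial m (zx e') (zy e') (s + r) s He').
  assert (G4 := lift_reach_arc m s (zx e') (zy e') (- t) Hs He').
  rewrite Back in G4. simpl in G4. rewrite <- Ez in G1, G4.
  assert (G := lift_reach_trans _ _ _ _ _ _ _ _ Hm
    (lift_reach_trans _ _ _ _ _ _ _ _ Hm G1 G2) (lift_reach_trans _ _ _ _ _ _ _ _ Hm G3 G4)).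
  replace h with (0 + - (t * ((s + r) * (s + r) * powr (s + r) (2 * m))) +
                  (0 + - (- t * (s * s * powr s (2 * m))))).
  - eapply lift_reach_weaken; [|apply G].
    (* Each half, a radial side and an arc, has length at most r + B r; two nested concatenations,
       with a factor 2 each, give 8 (1 + B) r. *)
    replace (s + r - s) with r by ring. replace (s - (s + r)) with (- r) by ring.
    rewrite !Rabs_Ropp, (Rabs_pos_eq r) by lra.
    assert (s * Rabs t <= B * r).
    { eapply Rle_trans; [|apply Ht]. apply Rmult_le_compat_r; [apply Rabs_pos | lra]. }
    lra.
  - fold w w'. transitivity (- t * (w - w')); [ring|]. unfold t. field. lra.
Qed.

(** * The ball-box estimate: boxes are contained in balls *)

(** A straight segment reaches the projection of [q], and a loop there corrects the height. The lift
    [h0] of the segment is not computed: [cc_lt_displacement], applied to the segment itself, shows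
    that it satisfies a box estimate, so the remaining height is a multiple of the weight. *)
Lemma box_cc_lt m p q r B :
  0 <= m -> 0 < r -> 0 <= B ->
  nrm2 (px q - px p) (py q - py p) <= r ->
  Rabs (pt q - pt p - cform m (fst p) (px q - px p) (py q - py p))
    <= B * weight m (nrm2 (px p) (py p)) r ->
  cc_lt m p q ((51 + 48 * (B + 4 * (1 + 2 * m))) * r).
Proof.
  intros Hm Hr HB Hz Ht.
  destruct (lift_reach_segment m (fst p) (fst q) Hm) as (h0 & Hseg).
  assert (Dz : dist2 (fst q) (fst p) <= r) by exact Hz.
  set (s := nrm2 (px p) (py p)) in *. set (s' := nrm2 (px q) (py q)).
  assert (Hs : 0 <= s) by apply nrm2_nonneg. assert (Hs' : 0 <= s') by apply nrm2_nonneg.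
  assert (Hss : s <= s' + r).
  { generalize (nrm2_le_dist2 (fst q) (fst p)). rewrite dist2_sym.
    change (nrm2 (zx (fst p)) (zy (fst p))) with s. change (nrm2 (zx (fst q)) (zy (fst q))) with s'. lra. }
  assert (C0 : cc_lt m p (fst q, pt p + h0) (2 * r)).
  { apply (lift_reach_cc m p (fst q, pt p + h0) (dist2 (fst q) (fst p))); [auto| |lra].
    change (pt (fst q, pt p + h0)) with (pt p + h0).
    replace (pt p + h0 - pt p) with h0 by ring. exact Hseg. }
  apply cc_lt_displacement in C0; [|auto]. destruct C0 as (_ & _ & C0).
  change (px (fst q, pt p + h0)) with (px q) in C0. change (py (fst q, pt p + h0)) with (py q) in C0.
  change (pt (fst q, pt p + h0)) with (pt p + h0) in C0. fold s in C0.
  set (B' := B + 4 * (1 + 2 * m)).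
  (* The segment has length at most r, hence strictly below 2 r; recentring from [p] to [q] uses s +
     2 r <= s' + 3 r, which fixes the loop size 3 r. The total is (50 + 48 B') r, and 51 makes the
     inequality strict. *)
  assert (Hloop : lift_reach m (fst q) (fst q) (pt q - pt p - h0) (8 * (1 + B') * (3 * r))).
  { apply lift_reach_loop; [lra | lra | unfold B'; lra |].
    change (nrm2 (zx (fst q)) (zy (fst q))) with s'.
    replace (pt q - pt p - h0) with
      ((pt q - pt p - cform m (fst p) (px q - px p) (py q - py p)) -
       (pt p + h0 - pt p - cform m (fst p) (px q - px p) (py q - py p))) by ring.
    eapply Rle_trans; [apply Rabs_triang|]. rewrite Rabs_Ropp.
    assert (W1 : weight m s r <= weight m s' (3 * r)) by (apply weight_incr; lra).
    assert (W2 : weight m s (2 * r) <= weight m s' (3 * r)) by (apply weight_incr; lra).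
    assert (W0 : 0 <= weight m s' (3 * r)) by apply weight_nonneg.
    assert (X1 : B * weight m s r <= B * weight m s' (3 * r)) by (apply Rmult_le_compat_l; lra).
    assert (X2 : (1 + 2 * m) * weight m s (2 * r) <= (1 + 2 * m) * weight m s' (3 * r))
      by (apply Rmult_le_compat_l; lra).
    unfold B'. nra. }
  assert (G := lift_reach_trans _ _ _ _ _ _ _ _ Hm Hseg Hloop).
  replace (h0 + (pt q - pt p - h0)) with (pt q - pt p) in G by ring.
  eapply lift_reach_cc; [auto | apply G |].
  apply Rle_lt_trans with (2 * (r + 8 * (1 + B') * (3 * r))); [lra|].
  replace (2 * (r + 8 * (1 + B') * (3 * r))) with ((50 + 48 * B') * r) by ring.
  apply Rmult_lt_compat_r; lra.
Qed.

Lemma cc_lt_mono m p q r r' : r <= r' -> cc_lt m p q r -> cc_lt m p q r'.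
Proof.
  intros H (z & L & HL & Hrest). exists z, L. split; [lra | exact Hrest].
Qed.

(** * Second-order estimates for the graph function *)

Lemma mean_value (f f' : R -> R) a b :
  (forall c, derivable_pt_lim f c (f' c)) ->
  exists c, Rabs (c - a) <= Rabs (b - a) /\ f b - f a = f' c * (b - a).
Proof.
  intros H. destruct (MVT_gen f a b f') as (c & Hc & E).
  - intros x _. apply is_derive_Reals, H.
  - intros x _. apply derivable_continuous_pt. exists (f' x). apply H.
  - exists c. split; auto. unfold Rmin, Rmax in Hc.
    destruct Rle_dec; unfold Rabs; repeat destruct Rcase_abs; lra.
Qed.

Lemma nrm2_le_abs_incr a b c d : Rabs a <= Rabs c -> Rabs b <= Rabs d -> nrm2 a b <= nrm2 c d.
Proof.
  intros H1 H2. apply nrm2_ge_of_sqr. rewrite nrm2_mul_self.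
  generalize (Rabs_pos a) (Rabs_pos b) (Rsqr_abs a) (Rsqr_abs b) (Rsqr_abs c) (Rsqr_abs d).
  unfold Rsqr. intros. nra.
Qed.

Lemma nrm2_add_le x y a b : nrm2 a b <= nrm2 x y + nrm2 (a - x) (b - y).
Proof. eapply Rle_trans; [|apply nrm2_triangle]. right; f_equal; ring. Qed.

(** One-variable mean values along a vertical and then a horizontal step. Both intermediate points
    stay within the distance of the endpoints from (x, y), so one value of the weight bounds both
    partial derivatives. *)
Lemma increment_le n C g gx gy x y x' y' :
  0 <= n -> 0 <= C -> is_dx g gx -> is_dy g gy ->
  (forall a b, Rabs (gx a b) <= C * powr (nrm2 a b) n) ->
  (forall a b, Rabs (gy a b) <= C * powr (nrm2 a b) n) ->
  Rabs (g x' y' - g x y)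
    <= 2 * C * powr (nrm2 x y + nrm2 (x' - x) (y' - y)) n * nrm2 (x' - x) (y' - y).
Proof.
  intros Hn HC Hx Hy Bx By.
  destruct (mean_value (fun s => g s y') (fun s => gx s y') x x') as (c & Hc & E1).
  { intros; apply Hx. }
  destruct (mean_value (fun s => g x s) (fun s => gy x s) y y') as (d & Hd & E2).
  { intros; apply Hy. }
  set (v := nrm2 (x' - x) (y' - y)). set (M := powr (nrm2 x y + v) n).
  assert (P : forall a b, Rabs (a - x) <= Rabs (x' - x) -> Rabs (b - y) <= Rabs (y' - y) ->
                          C * powr (nrm2 a b) n <= C * M).
  { intros a b Ha Hb. apply Rmult_le_compat_l; auto. apply powr_incr; auto.
    split; [apply nrm2_nonneg|]. eapply Rle_trans; [apply (nrm2_add_le x y)|].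
    generalize (nrm2_le_abs_incr _ _ _ _ Ha Hb). fold v. lra. }
  assert (Z : Rabs (x - x) <= Rabs (x' - x)) by (rewrite Rminus_diag, Rabs_R0; apply Rabs_pos).
  assert (Q1 := P c y' Hc (Rle_refl _)). assert (Q2 := P x d Z Hd).
  generalize (Bx c y') (By x d) (abs_le_nrm2_l (x' - x) (y' - y)) (abs_le_nrm2_r (x' - x) (y' - y)).
  fold v. intros.
  replace (g x' y' - g x y) with (gx c y' * (x' - x) + gy x d * (y' - y)) by lra.
  eapply Rle_trans; [apply Rabs_triang|]. rewrite !Rabs_mult.
  assert (Rabs (gx c y') * Rabs (x' - x) <= C * M * v) by (apply Rmult_le_compat; auto using Rabs_pos; lra).
  assert (Rabs (gy x d) * Rabs (y' - y) <= C * M * v) by (apply Rmult_le_compat; auto using Rabs_pos; lra).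
  lra.
Qed.

(** The same two steps, but the partial derivatives at the intermediate points are compared with
    those at (x, y); their Lipschitz bound supplies the second factor of the distance. *)
Lemma taylor_first_order n C f fx fy x y x' y' :
  0 <= n -> 0 <= C -> is_dx f fx -> is_dy f fy ->
  (forall a b a' b', Rabs (fx a' b' - fx a b)
     <= C * powr (nrm2 a b + nrm2 (a' - a) (b' - b)) n * nrm2 (a' - a) (b' - b)) ->
  (forall a b a' b', Rabs (fy a' b' - fy a b)
     <= C * powr (nrm2 a b + nrm2 (a' - a) (b' - b)) n * nrm2 (a' - a) (b' - b)) ->
  Rabs (f x' y' - f x y - (fx x y * (x' - x) + fy x y * (y' - y)))
    <= 2 * C * powr (nrm2 x y + nrm2 (x' - x) (y' - y)) n
         * (nrm2 (x' - x) (y' - y) * nrm2 (x' - x) (y' - y)).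
Proof.
  intros Hn HC Hx Hy Bx By.
  destruct (mean_value (fun s => f s y') (fun s => fx s y') x x') as (c & Hc & E1).
  { intros; apply Hx. }
  destruct (mean_value (fun s => f x s) (fun s => fy x s) y y') as (d & Hd & E2).
  { intros; apply Hy. }
  set (v := nrm2 (x' - x) (y' - y)). set (M := powr (nrm2 x y + v) n).
  assert (P : forall a b, Rabs (a - x) <= Rabs (x' - x) -> Rabs (b - y) <= Rabs (y' - y) ->
    C * powr (nrm2 x y + nrm2 (a - x) (b - y)) n * nrm2 (a - x) (b - y) <= C * M * v).
  { intros a b Ha Hb. assert (Q := nrm2_le_abs_incr _ _ _ _ Ha Hb). fold v in Q.
    generalize (nrm2_nonneg (a - x) (b - y)) (nrm2_nonneg x y). intros.
    apply Rmult_le_compat; auto.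
    - apply Rmult_le_pos; auto. apply powr_nonneg.
    - apply Rmult_le_compat_l; auto. apply powr_incr; lra. }
  assert (Z : Rabs (x - x) <= Rabs (x' - x)) by (rewrite Rminus_diag, Rabs_R0; apply Rabs_pos).
  assert (Q1 := Rle_trans _ _ _ (Bx x y c y') (P c y' Hc (Rle_refl _))).
  assert (Q2 := Rle_trans _ _ _ (By x y x d) (P x d Z Hd)).
  generalize (abs_le_nrm2_l (x' - x) (y' - y)) (abs_le_nrm2_r (x' - x) (y' - y)).
  fold v. intros.
  replace (f x' y' - f x y - (fx x y * (x' - x) + fy x y * (y' - y)))
    with ((fx c y' - fx x y) * (x' - x) + (fy x d - fy x y) * (y' - y)) by lra.
  eapply Rle_trans; [apply Rabs_triang|]. rewrite !Rabs_mult.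
  assert (Rabs (fx c y' - fx x y) * Rabs (x' - x) <= C * M * v * v)
    by (apply Rmult_le_compat; auto using Rabs_pos; lra).
  assert (Rabs (fy x d - fy x y) * Rabs (y' - y) <= C * M * v * v)
    by (apply Rmult_le_compat; auto using Rabs_pos; lra).
  lra.
Qed.

(** * Coordinates adapted to the graph *)

Definition height (phi : R -> R -> R) (p : R3) : R := pt p - phi (px p) (py p).

Definition dot (v : R * R) (a b : R) : R := zx v * a + zy v * b.

(** F is the horizontal gradient (X u, Y u) of the height u; the ball of radius r about p
    is, up to constants, the box |dz| <= r, |du - F(z) dz| <= weight(|z|, r). *)
Record graph_chart (m : R) (phi : R -> R -> R) (F : R * R -> R * R) (A : R) (K : R -> R) : Prop := {
  chart_const : 1 <= A;
  chart_K : forall B, 0 <= B -> 0 < K B;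
  chart_lip : forall w w' a b,
    Rabs (dot (F w') a b - dot (F w) a b)
      <= A * dist2 w' w * powr (nrm2 (zx w) (zy w) + dist2 w' w) (2 * m) * nrm2 a b;
  chart_displacement : forall p q r, cc_lt m p q r ->
    0 < r /\ dist2 (fst q) (fst p) <= r /\
    Rabs (height phi q - height phi p - dot (F (fst p)) (px q - px p) (py q - py p))
      <= A * weight m (nrm2 (px p) (py p)) r;
  chart_box : forall p q r B, 0 < r -> 0 <= B -> dist2 (fst q) (fst p) <= r ->
    Rabs (height phi q - height phi p - dot (F (fst p)) (px q - px p) (py q - py p))
      <= B * weight m (nrm2 (px p) (py p)) r ->
    cc_lt m p q (K B * r) }.

(** The deviation of the height is that of t minus the Taylor remainder of [phi]. The bound on the
    second derivatives has the growth of the weight, so the gradient of [phi] obeys the same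
    Lipschitz estimate as the contact form and the remainder is at most [4 * C] times [weight]; both
    ball-box inclusions survive with larger constants. *)
Lemma graph_chart_exists m phi C :
  0 <= m -> smooth2 phi -> 0 <= C ->
  (forall g x y, is_pd 2 phi g -> Rabs (g x y) <= C * powr (nrm2 x y) (2 * m)) ->
  exists F A K, graph_chart m phi F A K.
Proof.
  intros Hm Hs HC H2.
  destruct (Hs 0%nat phi (pd0 phi)) as (_ & (fx & Hfx) & (fy & Hfy)).
  assert (Px := pdx 0 phi phi fx (pd0 phi) Hfx). assert (Py := pdy 0 phi phi fy (pd0 phi) Hfy).
  destruct (Hs _ _ Px) as (_ & (fxx & Hfxx) & (fxy & Hfxy)).
  destruct (Hs _ _ Py) as (_ & (fyx & Hfyx) & (fyy & Hfyy)).
  assert (Lx : forall a b a' b', Rabs (fx a' b' - fx a b)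
     <= 2 * C * powr (nrm2 a b + nrm2 (a' - a) (b' - b)) (2 * m) * nrm2 (a' - a) (b' - b)).
  { intros. apply increment_le with fxx fxy; auto; try lra; intros; apply H2;
      [exact (pdx _ _ _ _ Px Hfxx) | exact (pdy _ _ _ _ Px Hfxy)]. }
  assert (Ly : forall a b a' b', Rabs (fy a' b' - fy a b)
     <= 2 * C * powr (nrm2 a b + nrm2 (a' - a) (b' - b)) (2 * m) * nrm2 (a' - a) (b' - b)).
  { intros. apply increment_le with fyx fyy; auto; try lra; intros; apply H2;
      [exact (pdx _ _ _ _ Py Hfyx) | exact (pdy _ _ _ _ Py Hfyy)]. }
  set (F := fun w => (formP m (zx w) (zy w) - fx (zx w) (zy w),
                      formQ m (zx w) (zy w) - fy (zx w) (zy w))).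
  assert (EF : forall w a b, dot (F w) a b
            = cform m w a b - (fx (zx w) (zy w) * a + fy (zx w) (zy w) * b)).
  { intros. unfold dot, F, cform. simpl. ring. }
  assert (T : forall p q r, dist2 (fst q) (fst p) <= r ->
    Rabs (phi (px q) (py q) - phi (px p) (py p) -
          (fx (px p) (py p) * (px q - px p) + fy (px p) (py p) * (py q - py p)))
    <= 4 * C * weight m (nrm2 (px p) (py p)) r).
  { intros p q r Hd. change (nrm2 (px q - px p) (py q - py p) <= r) in Hd.
    eapply Rle_trans; [apply (taylor_first_order (2 * m) (2 * C) phi fx fy); auto; lra|].
    generalize (nrm2_nonneg (px q - px p) (py q - py p)) (nrm2_nonneg (px p) (py p)). intros.
    replace (4 * C * weight m (nrm2 (px p) (py p)) r) with
      (2 * (2 * C) * powr (nrm2 (px p) (py p) + r) (2 * m) * (r * r)) by (unfold weight; ring).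
    apply Rmult_le_compat; [| nra | | nra].
    - apply Rmult_le_pos; [lra | apply powr_nonneg].
    - apply Rmult_le_compat_l; [lra|]. apply powr_incr; lra. }
  assert (EH : forall p q,
    height phi q - height phi p - dot (F (fst p)) (px q - px p) (py q - py p) =
    (pt q - pt p - cform m (fst p) (px q - px p) (py q - py p))
    - (phi (px q) (py q) - phi (px p) (py p) -
          (fx (px p) (py p) * (px q - px p) + fy (px p) (py p) * (py q - py p)))).
  { intros. rewrite EF. unfold height.
    change (zx (fst p)) with (px p). change (zy (fst p)) with (py p). ring. }
  (* In the Lipschitz estimate [4 * C] is [2 * C] for each partial derivative; in the displacement
     estimate it is the Taylor constant. [K B] is the constant of [box_cc_lt] for [B + 4 * C]. *)
  exists F, (1 + 2 * m + 4 * C), (fun B => 51 + 48 * ((B + 4 * C) + 4 * (1 + 2 * m))).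
  constructor.
  - lra.
  - intros; lra.
  - intros w w' a b. rewrite !EF.
    set (s := nrm2 (zx w) (zy w)). set (d := dist2 w' w). set (v := nrm2 a b).
    assert (Cf := cform_lipschitz m w w' (s + d) a b Hm
      ltac:(unfold d, s; generalize (dist2_nonneg w' w); lra) ltac:(apply nrm2_le_dist2)).
    fold d v in Cf.
    generalize (Lx (zx w) (zy w) (zx w') (zy w')) (Ly (zx w) (zy w) (zx w') (zy w'))
      (abs_le_nrm2_l a b) (abs_le_nrm2_r a b).
    change (nrm2 (zx w' - zx w) (zy w' - zy w)) with d. fold s v.
    set (P := powr (s + d) (2 * m)) in *. intros I1 I2 I3 I4.
    match goal with |- Rabs ?e <= _ =>
      replace e with ((cform m w' a b - cform m w a b)
        - ((fx (zx w') (zy w') - fx (zx w) (zy w)) * a + (fy (zx w') (zy w') - fy (zx w) (zy w)) * b))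
        by ring end.
    eapply Rle_trans; [apply Rabs_triang|]. rewrite Rabs_Ropp.
    eapply Rle_trans; [apply Rplus_le_compat_l, Rabs_triang|]. rewrite !Rabs_mult.
    assert (Rabs (fx (zx w') (zy w') - fx (zx w) (zy w)) * Rabs a <= 2 * C * P * d * v)
      by (apply Rmult_le_compat; auto using Rabs_pos).
    assert (Rabs (fy (zx w') (zy w') - fy (zx w) (zy w)) * Rabs b <= 2 * C * P * d * v)
      by (apply Rmult_le_compat; auto using Rabs_pos).
    lra.
  - intros p q r H. destruct (cc_lt_displacement m p q r Hm H) as (D1 & D2 & D3).
    split; [auto|]. split; [exact D2|]. rewrite EH.
    eapply Rle_trans; [apply Rabs_triang|]. rewrite Rabs_Ropp.
    generalize (T p q r D2). lra.
  - intros p q r B Hr HB Hd H. apply box_cc_lt; auto; [lra|].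
    rewrite EH in H. generalize (T p q r Hd). intros HT.
    match type of H with Rabs (?x - ?y) <= _ => replace x with ((x - y) + y) by ring end.
    eapply Rle_trans; [apply Rabs_triang|]. lra.
Qed.

(** * Points and boxes in the coordinates (z, u) *)

Lemma dot_le v a b : Rabs (dot v a b) <= nrm2 (zx v) (zy v) * nrm2 a b.
Proof. apply nrm2_cauchy_schwarz. Qed.

Definition point (phi : R -> R -> R) (z : R * R) (u : R) : R3 := (z, u + phi (zx z) (zy z)).

Lemma height_point phi z u : height phi (point phi z u) = u.
Proof. unfold height, point, px, py, pt, zx, zy; simpl. ring. Qed.

Lemma point_height phi p : point phi (fst p) (height phi p) = p.
Proof.
  destruct p as [z t]. unfold point, height, px, py, pt, zx, zy; simpl. f_equal. ring.
Qed.

Definition deviation (phi : R -> R -> R) (F : R * R -> R * R) (p q : R3) : R :=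
  height phi q - height phi p - dot (F (fst p)) (px q - px p) (py q - py p).

Definition box m phi F (p : R3) (B r : R) (q : R3) : Prop :=
  dist2 (fst q) (fst p) <= r /\
  Rabs (deviation phi F p q) <= B * weight m (nrm2 (px p) (py p)) r.

Lemma box_mono m phi F p B B' r r' q :
  0 <= m -> 0 <= B <= B' -> 0 <= r <= r' -> box m phi F p B r q -> box m phi F p B' r' q.
Proof.
  intros Hm HB Hr [H1 H2]. split; [lra|]. eapply Rle_trans; [apply H2|].
  apply Rmult_le_compat; [lra | apply weight_nonneg | lra |].
  apply weight_incr; try lra. apply nrm2_nonneg.
Qed.

(** With the centre fixed, the deviation is affine in (z, u) and the Euclidean norm is convex. This
    keeps the middle segment of the joining curve in the box that contains its endpoints. *)
Lemma box_convex m phi F p B r z1 u1 z2 u2 b :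
  0 <= b <= 1 ->
  box m phi F p B r (point phi z1 u1) -> box m phi F p B r (point phi z2 u2) ->
  box m phi F p B r (point phi ((1 - b) * zx z1 + b * zx z2, (1 - b) * zy z1 + b * zy z2)
                             ((1 - b) * u1 + b * u2)).
Proof.
  unfold box, deviation. rewrite !height_point. intros Hb [A1 A2] [B1 B2]. split.
  - unfold dist2 in *. unfold point, zx, zy in *; simpl in *.
    eapply Rle_trans; [eapply Rle_trans; [|apply (nrm2_triangle
      ((1 - b) * (fst z1 - fst (fst p))) ((1 - b) * (snd z1 - snd (fst p)))
      (b * (fst z2 - fst (fst p))) (b * (snd z2 - snd (fst p))))]|].
    + right; f_equal; ring.
    + rewrite !nrm2_scal, !Rabs_pos_eq by lra. nra.
  - unfold point, px, py, zx, zy in *; simpl in *.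
    match type of A2 with Rabs ?a <= ?w => match type of B2 with Rabs ?c <= _ =>
      match goal with |- Rabs ?e <= _ =>
        replace e with ((1 - b) * a + b * c) by (unfold dot, zx, zy; ring) end;
      set (X := a) in *; set (Y := c) in *; set (W := w) in * end end.
    eapply Rle_trans; [apply Rabs_triang|]. rewrite !Rabs_mult.
    rewrite (Rabs_pos_eq b), (Rabs_pos_eq (1 - b)) by lra. nra.
Qed.

(* The deviation of p2 from p1 is the difference of their deviations from p0, up to the
   variation of F between p0 and p1. *)
Lemma box_points_cc_lt m phi F A K p0 p1 p2 B r :
  0 <= m -> graph_chart m phi F A K -> 0 < r -> 0 <= B ->
  box m phi F p0 B r p1 -> box m phi F p0 B r p2 -> cc_lt m p1 p2 (K (2 * B + 2 * A) * (2 * r)).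
Proof.
  intros Hm Hch Hr HB [A1 A2] [B1 B2].
  assert (HA := chart_const _ _ _ _ _ Hch).
  assert (D : dist2 (fst p2) (fst p1) <= 2 * r).
  { generalize (dist2_triangle (fst p2) (fst p0) (fst p1)). rewrite (dist2_sym (fst p0)). lra. }
  apply (chart_box _ _ _ _ _ Hch); [lra | lra | exact D |].
  fold (deviation phi F p1 p2).
  set (s0 := nrm2 (px p0) (py p0)) in *. set (s1 := nrm2 (px p1) (py p1)).
  assert (S0 : 0 <= s0) by apply nrm2_nonneg.
  assert (S1 : s0 <= s1 + r).
  { generalize (nrm2_le_dist2 (fst p1) (fst p0)). rewrite dist2_sym. unfold s0, s1, px, py, zx, zy in *. lra. }
  apply Rle_trans with ((2 * B + 2 * A) * weight m s0 r).
  2: { apply Rmult_le_compat_l; [lra|]. apply weight_incr; lra. }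
  replace (deviation phi F p1 p2) with
    (deviation phi F p0 p2 - deviation phi F p0 p1
     - (dot (F (fst p1)) (px p2 - px p1) (py p2 - py p1)
        - dot (F (fst p0)) (px p2 - px p1) (py p2 - py p1)))
    by (unfold deviation, dot; ring).
  eapply Rle_trans; [apply Rabs_triang|]. rewrite Rabs_Ropp.
  assert (E : Rabs (deviation phi F p0 p2 - deviation phi F p0 p1) <= 2 * B * weight m s0 r).
  { eapply Rle_trans; [apply Rabs_triang|]. rewrite Rabs_Ropp. lra. }
  assert (E' : Rabs (dot (F (fst p1)) (px p2 - px p1) (py p2 - py p1)
        - dot (F (fst p0)) (px p2 - px p1) (py p2 - py p1)) <= 2 * A * weight m s0 r).
  { eapply Rle_trans; [apply (chart_lip _ _ _ _ _ Hch)|].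
    change (nrm2 (zx (fst p0)) (zy (fst p0))) with s0.
    replace (2 * A * weight m s0 r) with (A * r * powr (s0 + r) (2 * m) * (2 * r))
      by (unfold weight; ring).
    generalize (dist2_nonneg (fst p1) (fst p0)) (powr_nonneg (s0 + dist2 (fst p1) (fst p0)) (2 * m)).
    intros.
    apply Rmult_le_compat; [| apply nrm2_nonneg | | exact D].
    - repeat apply Rmult_le_pos; lra.
    - apply Rmult_le_compat; [nra | auto | nra | apply powr_incr; lra]. }
  lra.
Qed.

(** If u were at least 4 k s, the box could be enlarged to size 2 s' with 4 k s' = u, and all
    distances in it would be at most u. Passing to s' also covers s = 0, where no ball of radius
    proportional to s exists. *)
Lemma diam_lt_scale m phi F A K gamma a b p0 B s u :
  0 <= m -> graph_chart m phi F A K -> 0 <= B -> 0 <= s ->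
  (forall t, a <= t <= b -> box m phi F p0 B (2 * s) (gamma t)) ->
  0 < u -> diam_gt m gamma a b u -> u < 4 * K (2 * B + 2 * A) * s.
Proof.
  intros Hm Hch HB Hs Hbox Hu (s1 & s2 & H1 & H2 & Hgt).
  assert (HA := chart_const _ _ _ _ _ Hch).
  assert (HK := chart_K _ _ _ _ _ Hch (2 * B + 2 * A) ltac:(lra)).
  set (k := K (2 * B + 2 * A)) in *.
  apply Rnot_le_lt. intros Hle. apply Hgt. intros rho Hrho.
  set (s' := u / (4 * k)).
  assert (Hs' : 0 < s') by (apply Rdiv_lt_0_compat; lra).
  assert (Hss : s <= s').
  { apply Rmult_le_reg_l with (4 * k); [lra|]. unfold s'. field_simplify; lra. }
  apply cc_lt_mono with (k * (2 * (2 * s'))).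
  { unfold s'. replace (k * (2 * (2 * (u / (4 * k))))) with u by (field; lra). lra. }
  apply (box_points_cc_lt m phi F A K p0); auto; try lra;
    apply box_mono with B (2 * s); auto; lra.
Qed.

(** * Oscillation of the height over balls *)

(** Bounds the growth of the power r^{2m} when its argument is multiplied by at most 4; the summand
    1 makes it usable as a factor at least 1. *)
Definition spread (m : R) : R := 1 + powr 4 (2 * m).

Lemma spread_ge_1 m : 1 <= spread m.
Proof. unfold spread. generalize (powr_nonneg 4 (2 * m)). lra. Qed.

Lemma powr_le_spread m a b :
  0 <= m -> 0 <= a <= 4 * b -> powr a (2 * m) <= spread m * powr b (2 * m).
Proof.
  intros Hm H. eapply Rle_trans; [apply powr_incr; [lra | apply H]|].
  rewrite powr_mult by lra. apply Rmult_le_compat_r; [apply powr_nonneg | unfold spread; lra].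
Qed.

(** Size of the oscillation of the height over the ball of radius s about z. *)
Definition osc m F (z : R * R) (s : R) : R :=
  s * nrm2 (zx (F z)) (zy (F z)) + weight m (nrm2 (zx z) (zy z)) s.

Lemma osc_pos m F z s : 0 < s -> 0 < osc m F z s.
Proof.
  intros Hs. unfold osc.
  generalize (weight_pos m (nrm2 (zx z) (zy z)) s (nrm2_nonneg _ _) Hs) (nrm2_nonneg (zx (F z)) (zy (F z))).
  nra.
Qed.

(** Inside the ball the height drops by at most r (N + 3 A M s P): r N from F at [p0], two parts A M
    s P r from the variation of F over the distance 2 s, and one from the remainder of the ball-box
    estimate. Since 3 A M r < c s, this stays below c s (N + s P), which is c times [osc]. *)
Lemma ball_height_pos m phi F A K (p0 p q : R3) c s r :
  0 <= m -> graph_chart m phi F A K -> 0 < s -> 0 < c <= 1 ->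
  dist2 (fst p) (fst p0) <= 2 * s -> c * osc m F (fst p0) s <= height phi p ->
  cc_lt m p q r -> r < c / (3 * A * spread m) * s -> 0 < height phi q.
Proof.
  intros Hm Hch Hs Hc Hd Hh Hcc Hrs.
  assert (HA := chart_const _ _ _ _ _ Hch). assert (HM := spread_ge_1 m).
  destruct (chart_displacement _ _ _ _ _ Hch _ _ _ Hcc) as (Hr & Hdq & Hdev).
  set (M := spread m) in *. set (z0 := fst p0) in *.
  set (s0 := nrm2 (zx z0) (zy z0)). set (N := nrm2 (zx (F z0)) (zy (F z0))).
  assert (S0 : 0 <= s0) by apply nrm2_nonneg. assert (N0 : 0 <= N) by apply nrm2_nonneg.
  set (P := powr (s0 + s) (2 * m)). assert (P0 : 0 <= P) by apply powr_nonneg.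
  assert (AM : 1 <= A * M) by nra.
  assert (Hrs' : r * (3 * (A * M)) < c * s).
  { apply Rmult_lt_compat_r with (r := 3 * (A * M)) in Hrs; [|lra].
    replace (c / (3 * A * M) * s * (3 * (A * M))) with (c * s) in Hrs by (field; lra). auto. }
  assert (Hr_s : r <= s) by nra.
  set (dx := px q - px p) in *. set (dy := py q - py p) in *.
  assert (Hv : nrm2 dx dy <= r) by exact Hdq.
  assert (D1 : Rabs (dot (F z0) dx dy) <= N * r).
  { eapply Rle_trans; [apply dot_le|]. apply Rmult_le_compat_l; auto. }
  set (d := dist2 (fst p) z0) in *. assert (d0 : 0 <= d) by apply dist2_nonneg.
  assert (D2 : Rabs (dot (F (fst p)) dx dy - dot (F z0) dx dy) <= 2 * (A * M) * s * P * r).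
  { eapply Rle_trans; [apply (chart_lip _ _ _ _ _ Hch)|]. fold s0 d.
    replace (2 * (A * M) * s * P * r) with (A * (2 * s) * (M * P) * r) by ring.
    apply Rmult_le_compat; [| apply nrm2_nonneg | | exact Hv].
    - apply Rmult_le_pos; [nra | apply powr_nonneg].
    - apply Rmult_le_compat; [nra | apply powr_nonneg | nra |].
      apply powr_le_spread; lra. }
  assert (D3 : A * weight m (nrm2 (px p) (py p)) r <= A * M * s * P * r).
  { assert (Q : nrm2 (px p) (py p) <= s0 + d) by apply (nrm2_le_dist2 z0 (fst p)).
    assert (Q0 : 0 <= nrm2 (px p) (py p)) by apply nrm2_nonneg.
    assert (Q1 : powr (nrm2 (px p) (py p) + r) (2 * m) <= M * P) by (apply powr_le_spread; lra).
    assert (Q2 := powr_nonneg (nrm2 (px p) (py p) + r) (2 * m)).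
    replace (A * M * s * P * r) with (A * ((s * r) * (M * P))) by ring.
    unfold weight. apply Rmult_le_compat_l; [lra|]. apply Rmult_le_compat; auto; nra. }
  assert (Hlow : height phi p - r * (N + 3 * (A * M) * (s * P)) <= height phi q).
  { apply Rabs_le_between in Hdev, D1, D2. lra. }
  assert (Hosc : osc m F z0 s = s * (N + s * P)) by (unfold osc, weight; fold s0 N P; ring).
  rewrite Hosc in Hh.
  assert (sP : 0 < s * P).
  { apply Rmult_lt_0_compat; auto. apply powr_pos. lra. }
  assert (r * (N + 3 * (A * M) * (s * P)) <= r * (3 * (A * M)) * (N + s * P)).
  { rewrite (Rmult_assoc r (3 * (A * M))). apply Rmult_le_compat_l; [lra|]. nra. }
  assert (r * (3 * (A * M)) * (N + s * P) < c * s * (N + s * P)) by (apply Rmult_lt_compat_r; lra).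
  lra.
Qed.

(** The norm of F changes by at most A s (|z| + s)^{2m} over the distance s; times s this is A times
    the weight, which [osc] already contains. The weights themselves are comparable because |z| + s
    <= |z'| + 2 s. *)
Lemma osc_comparable m phi F A K z z' s :
  0 <= m -> graph_chart m phi F A K -> 0 <= s -> dist2 z' z <= s ->
  osc m F z s <= (1 + spread m + A * spread m) * osc m F z' s.
Proof.
  intros Hm Hch Hs Hd. assert (HA := chart_const _ _ _ _ _ Hch). assert (HM := spread_ge_1 m).
  unfold osc. set (N := nrm2 (zx (F z)) (zy (F z))). set (N' := nrm2 (zx (F z')) (zy (F z'))).
  set (t := nrm2 (zx z) (zy z)). set (t' := nrm2 (zx z') (zy z')).
  assert (N0 : 0 <= N') by apply nrm2_nonneg.
  assert (T0 : 0 <= t) by apply nrm2_nonneg. assert (T0' : 0 <= t') by apply nrm2_nonneg.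
  assert (T : t <= t' + s).
  { generalize (nrm2_le_dist2 z' z). fold t t'. rewrite dist2_sym. lra. }
  set (M := spread m) in *. set (P := powr (t + s) (2 * m)). set (P' := powr (t' + s) (2 * m)).
  assert (PP : P <= M * P') by (apply powr_le_spread; lra).
  assert (P0 : 0 <= P) by apply powr_nonneg. assert (P0' : 0 <= P') by apply powr_nonneg.
  assert (NN : N <= N' + A * s * P).
  { destruct (unit_direction (F z)) as (ex & ey & He & EF).
    assert (He2 : ex * ex + ey * ey = 1) by (rewrite <- nrm2_mul_self, He; ring).
    assert (E1 : dot (F z) ex ey = N).
    { unfold dot. rewrite EF at 1 2. simpl. fold N.
      transitivity (N * (ex * ex + ey * ey)); [ring | rewrite He2; ring]. }
    assert (E2 := dot_le (F z') ex ey). rewrite He in E2. fold N' in E2.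
    assert (E3 := chart_lip _ _ _ _ _ Hch z z' ex ey). rewrite He, E1 in E3. fold t in E3.
    assert (A * dist2 z' z * powr (t + dist2 z' z) (2 * m) * 1 <= A * s * P).
    { generalize (dist2_nonneg z' z) (powr_nonneg (t + dist2 z' z) (2 * m)). intros.
      rewrite Rmult_1_r.
      apply Rmult_le_compat; [nra | auto | nra | apply powr_incr; lra]. }
    apply Rabs_le_between in E2, E3. lra. }
  assert (s * N <= s * N' + A * (s * s * (M * P'))).
  { apply Rle_trans with (s * (N' + A * s * P)); [apply Rmult_le_compat_l; auto|].
    assert (A * (s * s * P) <= A * (s * s * (M * P'))).
    { apply Rmult_le_compat_l; [lra|]. apply Rmult_le_compat_l; [nra | auto]. }
    lra. }
  assert (s * s * P <= s * s * (M * P')) by (apply Rmult_le_compat_l; [nra | auto]).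
  unfold weight. fold P P'.
  assert (0 <= s * N') by nra. assert (0 <= s * s * P') by (apply Rmult_le_pos; [nra | auto]).
  assert (0 <= A * M) by nra. nra.
Qed.

(** Gives the continuity of the legs in their parameter. In the derivative of the power, the
    division by t + s is compensated by a factor s <= t + s from r^2. *)
Lemma weight_lipschitz m t d s s' :
  0 <= m -> 0 <= t -> 0 <= s <= d -> 0 <= s' <= d ->
  Rabs (weight m t s' - weight m t s) <= (2 + 2 * m) * d * powr (t + d) (2 * m) * Rabs (s' - s).
Proof.
  intros Hm Ht.
  assert (W : forall s s', 0 <= s <= s' -> s' <= d ->
    Rabs (weight m t s' - weight m t s) <= (2 + 2 * m) * d * powr (t + d) (2 * m) * (s' - s)).
  { clear s s'. intros s s' Hs Hs'.
    assert (M : weight m t s <= weight m t s') by (apply weight_incr; lra).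
    rewrite Rabs_pos_eq by lra. unfold weight.
    set (P := powr (t + s) (2 * m)). set (P' := powr (t + s') (2 * m)). set (Q := powr (t + d) (2 * m)).
    assert (P0 : 0 <= P') by apply powr_nonneg.
    assert (PP : P <= P') by (apply powr_incr; lra).
    assert (PQ : P' <= Q) by (apply powr_incr; lra).
    assert (L : (P' - P) * (t + s) <= 2 * m * (s' - s) * P').
    { unfold P, P'. replace (s' - s) with (t + s' - (t + s)) by ring. apply powr_sub_mul; lra. }
    assert (L' : s * (s * (P' - P)) <= d * (2 * m * (s' - s) * Q)).
    { apply Rmult_le_compat; [lra | apply Rmult_le_pos; lra | lra |].
      apply Rle_trans with ((P' - P) * (t + s)); [nra|]. eapply Rle_trans; [apply L|].
      apply Rmult_le_compat_l; [apply Rmult_le_pos; lra | auto]. }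
    assert (L'' : (s' - s) * (s' + s) * P' <= (s' - s) * (2 * d) * Q).
    { apply Rmult_le_compat; [apply Rmult_le_pos; lra | auto | apply Rmult_le_compat_l; lra | auto]. }
    lra. }
  intros Hs Hs'. destruct (Rle_dec s s').
  - rewrite (Rabs_pos_eq (s' - s)) by lra. apply W; lra.
  - rewrite Rabs_minus_sym, (Rabs_minus_sym s'), (Rabs_pos_eq (s - s')) by lra. apply W; lra.
Qed.

(** Leaves z in the direction (ex, ey) of F z while gaining height at the rate that the
    horizontal motion produces plus the vertical size of the box. *)
Definition leg_z (z : R * R) (ex ey s : R) : R * R := (zx z + s * ex, zy z + s * ey).
Definition leg_u m F (z : R * R) (u s : R) : R := u + osc m F z s.

(** In the direction of F(z) the predicted height increment is s |F(z)|, the first term of [osc];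
    the deviation is therefore exactly the weight. *)
Lemma leg_box m phi F z u ex ey s s' :
  0 <= m -> nrm2 ex ey = 1 -> dot (F z) ex ey = nrm2 (zx (F z)) (zy (F z)) -> 0 <= s <= s' ->
  box m phi F (point phi z u) 1 s' (point phi (leg_z z ex ey s) (leg_u m F z u s)).
Proof.
  intros Hm He HF Hs. apply box_mono with 1 s; auto; try lra.
  unfold box, deviation. rewrite !height_point. unfold dist2, leg_z, leg_u, osc, point, px, py, zx, zy; simpl.
  split.
  - replace (_ - fst z) with (s * ex) by ring. replace (_ - snd z) with (s * ey) by ring.
    rewrite nrm2_scal, He, Rabs_pos_eq; lra.
  - change (fst (F z)) with (zx (F z)). change (snd (F z)) with (zy (F z)). rewrite <- HF.
    unfold dot.
    match goal with |- Rabs ?e <= _ =>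
      replace e with (weight m (nrm2 (fst z) (snd z)) s) by (unfold zx, zy; ring) end.
    rewrite Rabs_pos_eq by apply weight_nonneg. lra.
Qed.

(** Every box contains a Euclidean neighbourhood of its centre in (z, u): the bound d <= r / 2 on
    each coordinate controls the projection, and d (1 + |F_x| + |F_y|) <= w controls the
    deviation. *)
Lemma point_curve_cc_continuous m phi F A K (zeta : R -> R * R) (u : R -> R) :
  0 <= m -> graph_chart m phi F A K ->
  (forall t, continuity_pt (fun t => zx (zeta t)) t) ->
  (forall t, continuity_pt (fun t => zy (zeta t)) t) ->
  (forall t, continuity_pt u t) ->
  cc_continuous m (fun t => point phi (zeta t) (u t)).
Proof.
  intros Hm Hch Cx Cy Cu s _ e He.
  assert (HK := chart_K _ _ _ _ _ Hch 1 ltac:(lra)).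
  set (r := e / K 1). assert (Hr : 0 < r) by (apply Rdiv_lt_0_compat; lra).
  set (w := weight m (nrm2 (zx (zeta s)) (zy (zeta s))) r).
  assert (Hw : 0 < w) by (apply weight_pos; [apply nrm2_nonneg | auto]).
  set (f := F (zeta s)). set (k := 1 + Rabs (zx f) + Rabs (zy f)).
  assert (K1 := Rabs_pos (zx f)). assert (K2 := Rabs_pos (zy f)).
  assert (Hk : 0 < k) by (unfold k; lra).
  set (d := Rmin (r / 2) (w / k)).
  assert (Hd : 0 < d) by (apply Rmin_pos; apply Rdiv_lt_0_compat; lra).
  assert (Hd1 : d <= r / 2) by apply Rmin_l.
  assert (Hd2 : d * k <= w).
  { apply Rle_trans with (w / k * k); [apply Rmult_le_compat_r; [lra | apply Rmin_r]|].
    right; field; lra. }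
  assert (Loc : forall g, continuity_pt g s -> exists eta, 0 < eta /\
            forall s', Rabs (s' - s) < eta -> Rabs (g s' - g s) <= d).
  { intros g Cg. destruct (Cg d Hd) as (eta & Heta & H). exists eta. split; auto.
    intros s' Hs'. destruct (Req_dec s' s) as [->|Hne].
    - rewrite Rminus_diag, Rabs_R0; lra.
    - left. apply (H s'). split; [split; [exact I | auto] | exact Hs']. }
  destruct (Loc _ (Cx s)) as (e1 & He1 & H1). destruct (Loc _ (Cy s)) as (e2 & He2 & H2).
  destruct (Loc _ (Cu s)) as (e3 & He3 & H3).
  exists (Rmin e1 (Rmin e2 e3)). split; [repeat apply Rmin_pos; auto|].
  intros s' _ Hs'.
  assert (M1 := Rmin_l e1 (Rmin e2 e3)). assert (M2 := Rmin_r e1 (Rmin e2 e3)).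
  assert (M3 := Rmin_l e2 e3). assert (M4 := Rmin_r e2 e3).
  specialize (H1 s' ltac:(lra)). specialize (H2 s' ltac:(lra)). specialize (H3 s' ltac:(lra)).
  replace e with (K 1 * r) by (unfold r; field; lra).
  apply (chart_box _ _ _ _ _ Hch); try lra.
  - unfold dist2, point; simpl. eapply Rle_trans; [apply nrm2_le_abs|]. lra.
  - rewrite !height_point. rewrite Rmult_1_l.
    change (weight m _ r) with w. unfold point, px, py; simpl. fold f. unfold dot.
    change (fst (zeta s')) with (zx (zeta s')). change (fst (zeta s)) with (zx (zeta s)).
    change (snd (zeta s')) with (zy (zeta s')). change (snd (zeta s)) with (zy (zeta s)).
    eapply Rle_trans; [apply Rabs_triang|]. rewrite Rabs_Ropp.
    eapply Rle_trans; [apply Rplus_le_compat_l, Rabs_triang|]. rewrite !Rabs_mult.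
    assert (Rabs (zx f) * Rabs (zx (zeta s') - zx (zeta s)) <= Rabs (zx f) * d)
      by (apply Rmult_le_compat_l; auto).
    assert (Rabs (zy f) * Rabs (zy (zeta s') - zy (zeta s)) <= Rabs (zy f) * d)
      by (apply Rmult_le_compat_l; auto).
    unfold k in Hd2. lra.
Qed.

Lemma dual_direction (v : R * R) :
  exists ex ey, nrm2 ex ey = 1 /\ dot v ex ey = nrm2 (zx v) (zy v).
Proof.
  destruct (unit_direction v) as (ex & ey & He & Ev). exists ex, ey. split; auto.
  assert (He2 : ex * ex + ey * ey = 1) by (rewrite <- nrm2_mul_self, He; ring).
  unfold dot. rewrite Ev at 1 2. simpl. set (N := nrm2 (zx v) (zy v)).
  transitivity (N * (ex * ex + ey * ey)); [ring | rewrite He2; ring].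
Qed.

(** Seen from [p], the leg from [q] has three sources of deviation: that of [q] itself (A), the
    weight gained along the leg ([spread m], since the centre moves), and the change of F between
    [p] and [q] along the displacement s e (A again). *)
Lemma leg_box_other m phi F A K (p q : R3) ex ey d s :
  0 <= m -> graph_chart m phi F A K -> cc_lt m p q d ->
  nrm2 ex ey = 1 -> dot (F (fst q)) ex ey = nrm2 (zx (F (fst q))) (zy (F (fst q))) ->
  0 <= s <= d ->
  box m phi F p (2 * A + spread m) (2 * d)
    (point phi (leg_z (fst q) ex ey s) (leg_u m F (fst q) (height phi q) s)).
Proof.
  intros Hm Hch Hcc He HF Hs. assert (HA := chart_const _ _ _ _ _ Hch).
  assert (HM := spread_ge_1 m).
  destruct (chart_displacement _ _ _ _ _ Hch _ _ _ Hcc) as (Hd & Hz & Hdev).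
  fold (deviation phi F p q) in Hdev.
  set (t := nrm2 (px p) (py p)) in *. set (t' := nrm2 (px q) (py q)).
  assert (T0 : 0 <= t) by apply nrm2_nonneg. assert (T0' : 0 <= t') by apply nrm2_nonneg.
  assert (T : t' <= t + d).
  { generalize (nrm2_le_dist2 (fst p) (fst q)).
    change (nrm2 (zx (fst q)) (zy (fst q))) with t'. change (nrm2 (zx (fst p)) (zy (fst p))) with t. lra. }
  assert (Dl : dist2 (leg_z (fst q) ex ey s) (fst q) = s).
  { unfold dist2, leg_z; simpl.
    replace (_ - zx (fst q)) with (s * ex) by ring. replace (_ - zy (fst q)) with (s * ey) by ring.
    rewrite nrm2_scal, He, Rabs_pos_eq; lra. }
  split.
  { unfold point; simpl. generalize (dist2_triangle (leg_z (fst q) ex ey s) (fst q) (fst p)). lra. }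
  fold t. apply Rle_trans with ((2 * A + spread m) * weight m t d).
  2: { apply Rmult_le_compat_l; [lra|]. apply weight_incr; lra. }
  assert (E : deviation phi F p (point phi (leg_z (fst q) ex ey s) (leg_u m F (fst q) (height phi q) s))
    = deviation phi F p q + weight m t' s
      + s * (dot (F (fst q)) ex ey - dot (F (fst p)) ex ey)).
  { rewrite HF. unfold deviation. rewrite height_point. unfold leg_u, osc.
    change (nrm2 (zx (fst q)) (zy (fst q))) with t'.
    unfold dot, point, leg_z, px, py, zx, zy; simpl. ring. }
  rewrite E.
  assert (W : weight m t' s <= spread m * weight m t d).
  { unfold weight. replace (spread m * (d * d * powr (t + d) (2 * m)))
      with (d * d * (spread m * powr (t + d) (2 * m))) by ring.
    apply Rmult_le_compat; [nra | apply powr_nonneg | nra |]. apply powr_le_spread; lra. }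
  assert (L : Rabs (dot (F (fst q)) ex ey - dot (F (fst p)) ex ey) <= A * d * powr (t + d) (2 * m)).
  { eapply Rle_trans; [apply (chart_lip _ _ _ _ _ Hch)|]. rewrite He, Rmult_1_r.
    change (nrm2 (zx (fst p)) (zy (fst p))) with t.
    generalize (dist2_nonneg (fst q) (fst p)). intros.
    apply Rmult_le_compat; [nra | apply powr_nonneg | nra | apply powr_incr; lra]. }
  eapply Rle_trans; [apply Rabs_triang|]. eapply Rle_trans; [apply Rplus_le_compat_r, Rabs_triang|].
  rewrite Rabs_mult, (Rabs_pos_eq s), (Rabs_pos_eq (weight m t' s)) by (apply weight_nonneg || lra).
  assert (s * Rabs (dot (F (fst q)) ex ey - dot (F (fst p)) ex ey) <= d * (A * d * powr (t + d) (2 * m))).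
  { apply Rmult_le_compat; [lra | apply Rabs_pos | lra | exact L]. }
  replace (d * (A * d * powr (t + d) (2 * m))) with (A * weight m t d) in H by (unfold weight; ring).
  lra.
Qed.

Definition mix (b : R) (w w' : R * R) : R * R :=
  ((1 - b) * zx w + b * zx w', (1 - b) * zy w + b * zy w').

Lemma mix_0 w w' : mix 0 w w' = w.
Proof. destruct w. unfold mix, zx, zy; simpl. f_equal; ring. Qed.

Lemma mix_1 w w' : mix 1 w w' = w'.
Proof. destruct w'. unfold mix, zx, zy; simpl. f_equal; ring. Qed.

Lemma clamp_affine_continuity k l t : continuity_pt (fun t => clamp (k * t + l)) t.
Proof.
  apply lipschitz_continuity_pt with (Rabs k); [apply Rabs_pos|]. intros t'.
  eapply Rle_trans; [apply clamp_lipschitz|].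
  replace (k * t' + l - (k * t + l)) with (k * (t' - t)) by ring.
  rewrite Rabs_mult. lra.
Qed.

Lemma leg_u_continuity m F z u d f t :
  0 <= m -> 0 <= d -> (forall t, 0 <= f t <= 1) -> (forall t, continuity_pt f t) ->
  continuity_pt (fun t => leg_u m F z u (d * f t)) t.
Proof.
  intros Hm Hd Hf Cf. unfold leg_u, osc.
  set (s := nrm2 (zx z) (zy z)). assert (Hs : 0 <= s) by apply nrm2_nonneg.
  assert (Cw : continuity_pt (fun t => weight m s (d * f t)) t).
  { assert (Cc : forall x, continuity_pt (fun x => weight m s (d * clamp x)) x).
    { intros x. set (k := (2 + 2 * m) * d * powr (s + d) (2 * m)).
      assert (Hk : 0 <= k).
      { apply Rmult_le_pos; [nra | apply powr_nonneg]. }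
      apply lipschitz_continuity_pt with (k * d); [nra|]. intros x'.
      assert (R1 := clamp_range x). assert (R2 := clamp_range x').
      eapply Rle_trans; [apply weight_lipschitz with (d := d); auto; nra|]. fold k.
      rewrite <- Rmult_minus_distr_l, Rabs_mult, (Rabs_pos_eq d), Rmult_assoc by auto.
      apply Rmult_le_compat_l; auto. apply Rmult_le_compat_l; auto. apply clamp_lipschitz. }
    apply continuity_pt_ext with (fun t => weight m s (d * clamp (f t))).
    { intros x. rewrite clamp_id; auto. }
    apply (continuity_pt_comp f (fun x => weight m s (d * clamp x))); auto. }
  apply continuity_pt_plus; [apply continuity_pt_const; red; auto|].
  apply continuity_pt_plus; [|exact Cw].
  apply continuity_pt_mult; [|apply continuity_pt_const; red; auto].
  apply continuity_pt_mult; [apply continuity_pt_const; red; auto | auto].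
Qed.

Lemma mix_continuity b f g t :
  continuity_pt b t -> continuity_pt f t -> continuity_pt g t ->
  continuity_pt (fun t => (1 - b t) * f t + b t * g t) t.
Proof.
  intros Hb Hf Hg. apply continuity_pt_plus; apply continuity_pt_mult; auto.
  apply continuity_pt_minus; auto. apply continuity_pt_const; red; auto.
Qed.

Lemma scaled_continuity x e d f t :
  continuity_pt f t -> continuity_pt (fun t => x + d * f t * e) t.
Proof.
  intros Hf. apply continuity_pt_plus; [apply continuity_pt_const; red; auto|].
  apply continuity_pt_mult; [|apply continuity_pt_const; red; auto].
  apply continuity_pt_mult; [apply continuity_pt_const; red; auto | auto].
Qed.

Lemma ratio_lt_of_scale c k r s :
  0 < c -> 0 < k -> r / (c / k) < k * s -> r < c * s.
Proof.
  intros Hc Hk H. apply Rmult_lt_reg_l with k; auto.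
  replace (k * r) with (r / (c / k) * c) by (field; lra).
  replace (k * (c * s)) with (k * s * c) by ring. apply Rmult_lt_compat_r; auto.
Qed.

(** * The joining curve and its ball condition *)

Lemma uniform_curve m phi F A K :
  0 <= m -> graph_chart m phi F A K ->
  exists eps kappa, 0 < eps /\ 0 < kappa /\
    forall p q d, epi phi p -> epi phi q -> cc_lt m p q d ->
      exists gamma : R -> R3,
        (forall s, 0 <= s <= 1 -> epi phi (gamma s)) /\
        gamma 0 = p /\ gamma 1 = q /\
        cc_continuous m gamma /\
        (forall s s', 0 <= s <= 1 -> 0 <= s' <= 1 -> cc_lt m (gamma s) (gamma s') (kappa * d)) /\
        (forall t, 0 <= t <= 1 -> ball_condition m (epi phi) gamma eps t).
Proof.
  intros Hm Hch. assert (HA := chart_const _ _ _ _ _ Hch). assert (HM := spread_ge_1 m).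
  set (M := spread m) in *. set (B := 2 * A + M). assert (HB : 1 <= B) by (unfold B; lra).
  assert (Hk := chart_K _ _ _ _ _ Hch (2 * B + 2 * A) ltac:(lra)).
  set (k := K (2 * B + 2 * A)) in *.
  assert (AM : 1 <= A * M) by nra.
  (* Inverse of the constant of [osc_comparable]: the top of the leg from [q] still has height at
     least c times the oscillation at [p]. *)
  set (c := / (1 + M + A * M)).
  assert (Hc : 0 < c) by (apply Rinv_0_lt_compat; lra).
  assert (Hc1 : c * (1 + M + A * M) = 1) by (unfold c; field; lra).
  assert (Hcle : c <= 1) by nra.
  set (c' := c / (3 * A * M)).
  assert (Hc' : 0 < c') by (apply Rdiv_lt_0_compat; [auto | nra]).
  (* A subarc in a box of size 2 s has diameter at most 4 k s, so eps times it is at most c' s, the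
     radius that [ball_height_pos] admits. *)
  exists (c' / (4 * k)), (4 * k).
  assert (Heps : 0 < c' / (4 * k)) by (apply Rdiv_lt_0_compat; lra).
  split; [exact Heps|]. split; [lra|].
  intros p q d Hp Hq Hcc.
  destruct (chart_displacement _ _ _ _ _ Hch _ _ _ Hcc) as (Hd & Hz & _).
  set (z0 := fst p) in *. set (z1 := fst q) in *.
  set (u0 := height phi p). set (u1 := height phi q).
  assert (Hu0 : 0 < u0) by (unfold u0, height, epi in *; lra).
  assert (Hu1 : 0 < u1) by (unfold u1, height, epi in *; lra).
  destruct (dual_direction (F z0)) as (ex & ey & He & HF).
  destruct (dual_direction (F z1)) as (ex' & ey' & He' & HF').
  (* [a] climbs the leg from p on the first third of [0, 1], [b] runs the segment between the tops
     on the second, and [e] descends the leg to q on the last. *)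
  set (a := fun t => clamp (3 * t + 0)). set (b := fun t => clamp (3 * t + -1)).
  set (e := fun t => clamp (- 3 * t + 3)).
  assert (Ra : forall t, 0 <= a t <= 1) by (intros; apply clamp_range).
  assert (Rb : forall t, 0 <= b t <= 1) by (intros; apply clamp_range).
  assert (Re : forall t, 0 <= e t <= 1) by (intros; apply clamp_range).
  set (za := fun t => leg_z z0 ex ey (d * a t)). set (ua := fun t => leg_u m F z0 u0 (d * a t)).
  set (ze := fun t => leg_z z1 ex' ey' (d * e t)). set (ue := fun t => leg_u m F z1 u1 (d * e t)).
  set (zeta := fun t => mix (b t) (za t) (ze t)).
  set (u := fun t => (1 - b t) * ua t + b t * ue t).
  set (gamma := fun t => point phi (zeta t) (u t)).
  assert (Hgl : forall t, 0 <= t <= /3 -> gamma t = point phi (leg_z z0 ex ey (d * (3 * t)))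
                                                        (leg_u m F z0 u0 (d * (3 * t)))).
  { intros t Ht. unfold gamma, zeta, u, b. rewrite clamp_le_0 by lra. rewrite mix_0.
    unfold za, ua, a. rewrite clamp_id by lra. rewrite Rplus_0_r. f_equal. ring. }
  assert (Hgr : forall t, 2 / 3 <= t <= 1 -> gamma t = point phi (leg_z z1 ex' ey' (d * (3 * (1 - t))))
                                                        (leg_u m F z1 u1 (d * (3 * (1 - t))))).
  { intros t Ht. unfold gamma, zeta, u, b. rewrite clamp_ge_1 by lra. rewrite mix_1.
    unfold ze, ue, e. rewrite clamp_id by lra. replace (- 3 * t + 3) with (3 * (1 - t)) by ring.
    f_equal. ring. }
  assert (Pp : point phi z0 u0 = p) by apply point_height.
  assert (Pq : point phi z1 u1 = q) by apply point_height.
  assert (ua_ge : forall t, u0 <= ua t).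
  { intros t. unfold ua, leg_u, osc. generalize (weight_nonneg m (nrm2 (zx z0) (zy z0)) (d * a t))
      (nrm2_nonneg (zx (F z0)) (zy (F z0))) (Ra t). intros.
    assert (0 <= d * a t) by (apply Rmult_le_pos; lra). nra. }
  assert (ue_ge : forall t, u1 <= ue t).
  { intros t. unfold ue, leg_u, osc. generalize (weight_nonneg m (nrm2 (zx z1) (zy z1)) (d * e t))
      (nrm2_nonneg (zx (F z1)) (zy (F z1))) (Re t). intros.
    assert (0 <= d * e t) by (apply Rmult_le_pos; lra). nra. }
  assert (leg0 : forall z ex ey, leg_z z ex ey 0 = z).
  { intros [x y] ? ?. unfold leg_z, zx, zy; simpl. f_equal; ring. }
  assert (legu0 : forall z u, leg_u m F z u 0 = u).
  { intros z v. unfold leg_u, osc, weight. ring. }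
  assert (Hbox : forall t, box m phi F p B (2 * d) (gamma t)).
  { intros t. unfold gamma, zeta, u, mix. apply box_convex; auto.
    - rewrite <- Pp. apply box_mono with 1 d; auto; try lra. apply leg_box; auto.
      generalize (Ra t). nra.
    - apply leg_box_other with K; auto. generalize (Re t). nra. }
  exists gamma. refine (conj _ (conj _ (conj _ (conj _ (conj _ _))))).
  - intros s _. change (phi (zx (zeta s)) (zy (zeta s)) < u s + phi (zx (zeta s)) (zy (zeta s))).
    unfold u. generalize (Rb s) (ua_ge s) (ue_ge s). nra.
  - rewrite Hgl by lra. replace (d * (3 * 0)) with 0 by ring. rewrite leg0, legu0. auto.
  - rewrite Hgr by lra. replace (d * (3 * (1 - 1))) with 0 by ring. rewrite leg0, legu0. auto.
  - assert (Ca : forall t, continuity_pt a t) by (intros; apply clamp_affine_continuity).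
    assert (Cb : forall t, continuity_pt b t) by (intros; apply clamp_affine_continuity).
    assert (Ce : forall t, continuity_pt e t) by (intros; apply clamp_affine_continuity).
    apply (point_curve_cc_continuous m phi F A K); auto; intros t; unfold zeta, u, mix; simpl;
      apply mix_continuity; auto.
    1, 2: apply scaled_continuity; auto.
    1, 2: apply scaled_continuity; auto.
    1, 2: apply leg_u_continuity; auto; lra.
  - intros s s' _ _. replace (4 * k * d) with (k * (2 * (2 * d))) by ring.
    apply (box_points_cc_lt m phi F A K p); auto; lra.
  - intros t Ht q' r Hcc' Hd1 Hd2.
    destruct (chart_displacement _ _ _ _ _ Hch _ _ _ Hcc') as (Hr & _ & _).
    assert (Hr' : 0 < r / (c' / (4 * k))) by (apply Rdiv_lt_0_compat; auto).
    enough (0 < height phi q') by (unfold height, epi in *; lra).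
    (* On an outer third the subarc from the nearer endpoint lies in a box of the current leg scale
       s about that endpoint. In the middle the scale is d, and the height is a convex combination
       of the heights of the two tops, each at least c times the oscillation at p. *)
    destruct (Rle_dec t (/3)) as [Hl|Hl]; [|destruct (Rle_dec (2/3) t) as [Hg|Hg]].
    + set (s := d * (3 * t)).
      assert (Hs0 : 0 <= s) by (apply Rmult_le_pos; lra).
      assert (Hb : forall x, 0 <= x <= t -> box m phi F p B (2 * s) (gamma x)).
      { intros x Hx. rewrite Hgl by lra. rewrite <- Pp. apply box_mono with 1 s; auto; try lra.
        apply leg_box; auto. unfold s. split; [nra|]. apply Rmult_le_compat_l; lra. }
      assert (Hrs : r < c' * s).
      { apply ratio_lt_of_scale with (4 * k); auto; try lra.
        apply (diam_lt_scale m phi F A K gamma 0 t p B); auto; lra. }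
      apply (ball_height_pos m phi F A K p (gamma t) q' c s r); auto.
      * nra.
      * apply Hb; lra.
      * fold z0. rewrite Hgl, height_point by lra. unfold leg_u. fold s.
        assert (0 < s) by nra. generalize (osc_pos m F z0 s H). nra.
    + set (s := d * (3 * (1 - t))).
      assert (Hs0 : 0 <= s) by (apply Rmult_le_pos; lra).
      assert (Hb : forall x, t <= x <= 1 -> box m phi F q B (2 * s) (gamma x)).
      { intros x Hx. rewrite Hgr by lra. rewrite <- Pq. apply box_mono with 1 s; auto; try lra.
        apply leg_box; auto. unfold s. split; [nra|]. apply Rmult_le_compat_l; lra. }
      assert (Hrs : r < c' * s).
      { apply ratio_lt_of_scale with (4 * k); auto; try lra.
        apply (diam_lt_scale m phi F A K gamma t 1 q B); auto; lra. }
      apply (ball_height_pos m phi F A K q (gamma t) q' c s r); auto.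
      * nra.
      * apply Hb; lra.
      * fold z1. rewrite Hgr, height_point by lra. unfold leg_u. fold s.
        assert (0 < s) by nra. generalize (osc_pos m F z1 s H). nra.
    + assert (Hrs : r < c' * d).
      { apply ratio_lt_of_scale with (4 * k); auto; try lra.
        apply (diam_lt_scale m phi F A K gamma 0 t p B); auto; lra. }
      apply (ball_height_pos m phi F A K p (gamma t) q' c d r); auto.
      * apply Hbox.
      * fold z0. unfold gamma. rewrite height_point. unfold u, ua, ue, a, e.
        rewrite !clamp_ge_1 by lra. rewrite Rmult_1_r. unfold leg_u.
        assert (O := osc_comparable m phi F A K z0 z1 d Hm Hch ltac:(lra) Hz). fold M in O.
        assert (O0 := osc_pos m F z0 d Hd). assert (O1 := osc_pos m F z1 d Hd).
        assert (c * osc m F z0 d <= osc m F z1 d).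
        { apply Rle_trans with (c * ((1 + M + A * M) * osc m F z1 d)).
          - apply Rmult_le_compat_l; lra.
          - rewrite <- Rmult_assoc, Hc1. lra. }
        assert (c * osc m F z0 d <= osc m F z0 d) by nra.
        generalize (Rb t). nra.
Qed.

(** * Positivity and finiteness of the distance, and the conclusion *)

Lemma cc_lt_refl m phi F A K p r :
  graph_chart m phi F A K -> 0 < r -> cc_lt m p p r.
Proof.
  intros Hch Hr. assert (HK := chart_K _ _ _ _ _ Hch 0 ltac:(lra)).
  replace r with (K 0 * (r / K 0)) by (field; lra).
  assert (0 < r / K 0) by (apply Rdiv_lt_0_compat; lra).
  apply (chart_box _ _ _ _ _ Hch); try lra.
  - rewrite dist2_refl. lra.
  - unfold dot. rewrite !Rminus_diag, !Rmult_0_r, Rplus_0_r, Rminus_diag, Rabs_R0. lra.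
Qed.

(** [chart_box] admits every B, so any deviation, however large, fits into a box of fixed radius. *)
Lemma cc_lt_connected m phi F A K p q :
  graph_chart m phi F A K -> exists r, cc_lt m p q r.
Proof.
  intros Hch. set (r := dist2 (fst q) (fst p) + 1).
  assert (Hr : 0 < r) by (unfold r; generalize (dist2_nonneg (fst q) (fst p)); lra).
  assert (W := weight_pos m (nrm2 (px p) (py p)) r (nrm2_nonneg _ _) Hr).
  set (w := weight m (nrm2 (px p) (py p)) r) in *.
  exists (K (Rabs (deviation phi F p q) / w) * r).
  apply (chart_box _ _ _ _ _ Hch); auto.
  - apply Rdiv_le_0_compat; [apply Rabs_pos | auto].
  - unfold r. lra.
  - fold w. fold (deviation phi F p q). right. field. lra.
Qed.

(** The projections agree, and then the height difference is at most A r^2 (|z| + r)^{2m} for every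
    r. Needed because the joining curve is built at a scale strictly above d(p, q), for which a
    multiple of d(p, q) serves only when the distance is positive. *)
Lemma cc_dist_zero_eq m phi F A K p q :
  0 <= m -> graph_chart m phi F A K -> (forall r, 0 < r -> cc_lt m p q r) -> p = q.
Proof.
  intros Hm Hch H. assert (HA := chart_const _ _ _ _ _ Hch).
  assert (Z : dist2 (fst q) (fst p) <= 0).
  { apply le_epsilon. intros e He. rewrite Rplus_0_l.
    apply (chart_displacement _ _ _ _ _ Hch _ _ _ (H e He)). }
  assert (Zx := abs_le_nrm2_l (px q - px p) (py q - py p)).
  assert (Zy := abs_le_nrm2_r (px q - px p) (py q - py p)).
  change (nrm2 (px q - px p) (py q - py p)) with (dist2 (fst q) (fst p)) in *.
  assert (X : px q - px p = 0).
  { apply Rabs_eq_0. generalize (Rabs_pos (px q - px p)). lra. }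
  assert (Y : py q - py p = 0).
  { apply Rabs_eq_0. generalize (Rabs_pos (py q - py p)). lra. }
  set (s := nrm2 (px p) (py p)). assert (S0 : 0 <= s) by apply nrm2_nonneg.
  set (P := powr (s + 1) (2 * m)). assert (P0 : 0 <= P) by apply powr_nonneg.
  assert (U : Rabs (height phi q - height phi p) <= 0).
  { apply le_epsilon. intros e He. rewrite Rplus_0_l.
    set (r := Rmin 1 (e / (A * P + 1))).
    assert (AP : 0 <= A * P) by (apply Rmult_le_pos; lra).
    assert (Hr : 0 < r) by (apply Rmin_pos; [lra | apply Rdiv_lt_0_compat; lra]).
    assert (R1 : r <= 1) by apply Rmin_l.
    assert (R2 : (A * P + 1) * r <= e).
    { apply Rle_trans with ((A * P + 1) * (e / (A * P + 1))).
      - apply Rmult_le_compat_l; [lra | apply Rmin_r].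
      - right; field; lra. }
    destruct (chart_displacement _ _ _ _ _ Hch _ _ _ (H r Hr)) as (_ & _ & D).
    rewrite X, Y in D. unfold dot in D. rewrite !Rmult_0_r, Rplus_0_r, Rminus_0_r in D.
    eapply Rle_trans; [apply D|]. fold s. apply Rle_trans with (A * P * r); [|lra].
    unfold weight. replace (A * P * r) with (A * (1 * r * P)) by ring.
    apply Rmult_le_compat_l; [lra|].
    apply Rmult_le_compat; [nra | apply powr_nonneg | nra | apply powr_incr; lra]. }
  assert (U' : height phi q - height phi p = 0).
  { apply Rabs_eq_0. generalize (Rabs_pos (height phi q - height phi p)). lra. }
  rewrite <- (point_height phi p), <- (point_height phi q). f_equal; [|lra].
  rewrite (surjective_pairing (fst p)), (surjective_pairing (fst q)).
  unfold px, py in X, Y. f_equal; lra.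
Qed.

Lemma graph_chart_uniform_domain m phi F A K :
  0 <= m -> graph_chart m phi F A K -> uniform_domain m (epi phi).
Proof.
  intros Hm Hch. destruct (uniform_curve m phi F A K Hm Hch) as (eps & k & Heps & Hk & H).
  exists eps, (/ (2 * k)). split; auto. split; [apply Rinv_0_lt_compat; lra|].
  rewrite Rinv_inv.
  intros p q Hp Hq.
  (* Suprema are available, so the distance is obtained as - l, with l the supremum of the negated
     admissible radii. *)
  destruct (completeness (fun x => cc_lt m p q (- x))) as (l & Hub & Hlub).
  { exists 0. intros x Hx. destruct (chart_displacement _ _ _ _ _ Hch _ _ _ Hx) as (Hx' & _). lra. }
  { destruct (cc_lt_connected m phi F A K p q Hch) as (r & Hr). exists (- r).
    rewrite Ropp_involutive. exact Hr. }
  assert (Hl : l <= 0).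
  { apply Hlub. intros x Hx. destruct (chart_displacement _ _ _ _ _ Hch _ _ _ Hx) as (Hx' & _). lra. }
  assert (Happ : forall r, - l < r -> cc_lt m p q r).
  { intros r Hr. apply NNPP. intros Hn.
    assert (l <= - r); [|lra]. apply Hlub. intros x Hx. apply Rnot_lt_le. intros Hlt.
    apply Hn, (cc_lt_mono m p q (- x)); [lra | exact Hx]. }
  destruct (Req_dec l 0) as [E|E].
  - assert (p = q) as <-.
    { apply (cc_dist_zero_eq m phi F A K); auto. intros r Hr. apply Happ. lra. }
    assert (Hrefl : forall r, 0 < r -> cc_lt m p p r).
    { intros r Hr. apply (cc_lt_refl m phi F A K); auto. }
    exists (fun _ => p). refine (conj _ (conj _ (conj _ (conj _ (conj _ _))))); auto.
    + intros s _ e He. exists 1. split; [lra | auto].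
    + intros s1 s2 _ _ r Hr. destruct (chart_displacement _ _ _ _ _ Hch _ _ _ Hr) as (Hr' & _).
      apply Hrefl. nra.
    + intros t _ q' r Hr (s1 & s2 & _ & _ & Hgt) _. exfalso.
      destruct (chart_displacement _ _ _ _ _ Hch _ _ _ Hr) as (Hr' & _).
      apply Hgt. intros rho Hrho. apply Hrefl.
      assert (0 < r / eps) by (apply Rdiv_lt_0_compat; lra). lra.
  (* The curve is taken at scale 2 d(p, q), which explains the 2 in delta = 1 / (2 k). *)
  - destruct (H p q (2 * - l) Hp Hq (Happ (2 * - l) ltac:(lra))) as (gamma & G1 & G2 & G3 & G4 & G5 & G6).
    exists gamma. refine (conj _ (conj _ (conj _ (conj _ (conj _ _))))); auto.
    intros s1 s2 Hs1 Hs2 r Hr.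
    apply cc_lt_mono with (k * (2 * - l)); [|apply G5; auto].
    assert (- r <= l) by (apply Hub; rewrite Ropp_involutive; exact Hr).
    replace (2 * k * r) with (k * (2 * r)) by ring. apply Rmult_le_compat_l; lra.
Qed.

Theorem theorem6p2 (m : R) (phi : R -> R -> R) (C : R) :
  1 <= m ->
  smooth2 phi ->
  0 < C ->
  (forall g x y, is_pd 3 phi g -> Rabs (g x y) <= C * powr (nrm2 x y) (2 * m - 1)) ->
  (forall g x y, is_pd 2 phi g -> Rabs (g x y) <= C * powr (nrm2 x y) (2 * m)) ->
  (forall g x y, is_pd 1 phi g -> Rabs (g x y) <= C * powr (nrm2 x y) (2 * m + 1)) ->
  uniform_domain m (epi phi).
Proof.
  intros Hm Hs HC _ H2 _.
  destruct (graph_chart_exists m phi C) as (F & A & K & Hch); auto; try lra.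
  apply (graph_chart_uniform_domain m phi F A K); auto; lra.
Qed.
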